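(* Let $m\ge 0$ and let $X$ be an $m$-fibrous space, and suppose $X$ has a fibrous decomposition $X_0(Y_1)X_1\dots(Y_n)X_n$, determined by pairs $(X_0,A_0),\dots,(X_n,A_n)$, spaces $Y_1,\dots,Y_n$ and maps $\underline{f_i},\overline{f_i}$ ($i=0,\dots,n$), each of whose spaces $X_0,\dots,X_n,Y_1,\dots,Y_n$ is $k$-fibrous for some $k\le m-1$ (when $m\geq 1$). Then the Euler-Poincaré characteristic is defined for each of $X_0,X_1,\dots,X_n$ and $Y_1,\dots,Y_n$, as well as for $X$, and $$\chi(X)=\chi(X_0)-\chi(Y_1)+\chi(X_1)-\cdots+\chi(X_{n-1})-\chi(Y_n)+\chi(X_n).$$
   Context: All spaces are Hausdorff. The Euler-Poincaré characteristic $\chi(Z)$ of a space $Z$ is said to be defined when its singular homology (with field coefficients, e.g. $\mathbb{Q}$) has finite total dimension; then $\chi(Z)=\sum_i(-1)^i\dim H_i(Z)$. Fibrous decomposition: Let $(X_i,A_i)$, $i=0,1,\dots,n$, be pairs of spaces ($A_i\subseteq X_i$) and $Y_j$, $j=1,\dots,n$, spaces, all of $X_0,\dots,X_n,Y_1,\dots,Y_n$ mutually disjoint. Let $\mathcal{Y}$ be the disjoint topological sum of the $X_i$ ($i=0,\dots,n$) and the $Y_j\times[j-1,j]$ ($j=1,\dots,n$). Let continuous surjections be given: $f_0: Y_1\times\{0\}\to A_0$, $f_n:Y_n\times\{n\}\to A_n$, and for $i=1,\dots,n-1$, $\underline{f_i}: Y_i\times\{i\}\to A_i$ and $\overline{f_i}: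 Y_{i+1}\times\{i\}\to A_i$; set $\underline{f_0}=\overline{f_0}=f_0$ and $\underline{f_n}=\overline{f_n}=f_n$. The quotient space $X$ is obtained from $\mathcal{Y}$ by identifying, for each $i$ and each $a\in A_i$, the point $a$ with all points of $\underline{f_i}^{-1}(a)$ and $\overline{f_i}^{-1}(a)$, all other points being identified only with themselves. The embedded copies $\overline{X_i}$ of $X_i$ and $\overline{Y_i}(t)$ of $Y_i\times\{t\}$, $t\in(i-1,i)$, are called fibers; they form an ordered decomposition of $X$, called a fibrous decomposition, denoted $X_0(Y_1)X_1\dots(Y_n)X_n$, of length $n$. When $n=0$ the decomposition is just $X_0$ (so $X=X_0$). $m$-fibrous spaces (inductive definition): a finite space is $0$-fibrous (its own fibrous decomposition). For $m\ge1$, a space is $m$-fibrous if it has a fibrous decomposition each fiber of which (i.e. each of the spaces $X_i$ and $Y_j$) is $k$-fibrous for some $k\le m-1$. *)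

(* Defs.v *)
From HB Require Import structures.
From mathcomp Require Import all_boot all_order all_algebra.
From mathcomp Require Import all_classical all_reals all_analysis.
From mathcomp Require Import Rstruct Rstruct_topology.


Unset Strict Implicit.
Unset Printing Implicit Defensive.

Import Order.TTheory GRing.Theory Num.Theory.
Local Open Scope classical_set_scope.
Local Open Scope ring_scope.

Notation R := Rdefinitions.R.

Definition Delta (n : nat) : set 'rV[R]_n.+1 :=
  [set x | (forall i, 0 <= x ord0 i) /\ \sum_i x ord0 i = 1].

Definition face_vec (n : nat) (i : 'I_n.+2) (x : 'rV[R]_n.+1) : 'rV[R]_n.+2 :=
  \row_j (if unlift i j is Some k then x ord0 k else 0).

Lemma face_vecP (n : nat) (i : 'I_n.+2) (x : Delta n) :
  face_vec n i (set_val x) \in Delta n.+1.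
Proof.
case: x => x xD; have [x0 x1] := set_mem xD.
rewrite set_valE /=.
apply/mem_set; split.
  by move=> j; rewrite mxE; case: (unlift i j) => // k; exact: x0.
rewrite (bigD1_ord i) //= mxE unlift_none add0r.
rewrite -x1; apply: eq_bigr => k _; by rewrite mxE liftK.
Qed.

Definition face_pt (n : nat) (i : 'I_n.+2) (x : Delta n) : Delta n.+1 :=
  exist (fun y => y \in Delta n.+1) (face_vec n i (set_val x)) (face_vecP n i x).

(* Singular n-chains with rational coefficients on a space T, represented as
   finite formal sums (lists of coefficient/simplex pairs).  A singular
   n-simplex is a continuous map from the standard simplex Delta n (with the
   subspace topology) to T. *)
Definition chain (n : nat) (T : topologicalType) : Type :=
  seq (rat * (Delta n -> T)).

Definition sing_chain (n : nat) (T : topologicalType) (c : chain n T) : Prop :=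
  List.Forall (fun p => continuous p.2) c.
Arguments sing_chain {n T}.

Definition coef (n : nat) (T : topologicalType) (c : chain n T) (s : Delta n -> T) : rat :=
  \sum_(p <- c) (if `[< p.2 = s >] then p.1 else 0).
Arguments coef {n T}.

Definition bd (n : nat) (T : topologicalType) (c : chain n.+1 T) : chain n T :=
  flatten [seq [seq ((-1) ^+ i * p.1, p.2 \o face_pt n i) | i : 'I_n.+2 <- enum 'I_n.+2] | p : rat * (Delta n.+1 -> T) <- c].
Arguments bd {n T}.

Definition cycle (n : nat) (T : topologicalType) : chain n T -> Prop :=
  match n return chain n T -> Prop with
  | 0 => fun c => sing_chain c
  | n'.+1 => fun c => sing_chain c /\ coef (bd c) =1 (fun _ => 0)
  end.
Arguments cycle {n T}.

Definition hspans (n : nat) (T : topologicalType) (d : nat) : Prop :=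
  exists z : 'I_d -> chain n T, (forall k, cycle (z k)) /\
    forall c : chain n T, cycle c ->
      exists (a : 'I_d -> rat) (b : chain n.+1 T), sing_chain b /\
        forall s, coef c s = \sum_(k < d) a k * coef (z k) s + coef (bd b) s.

Definition hdim (n : nat) (T : topologicalType) (d : nat) : Prop :=
  hspans n T d /\ forall d', hspans n T d' -> (d <= d')%N.

Definition euler_char (T : topologicalType) (e : int) : Prop :=
  exists N : nat, (forall n, (N <= n)%N -> hdim n T 0) /\
    exists ds : nat -> nat, (forall n, (n < N)%N -> hdim n T (ds n)) /\
      e = \sum_(k < N) (-1) ^+ k * (ds k)%:Z.

(* Points of the disjoint sum: a point of some X_i, or a point (y, t) of
   some Y_j x R (only t in [j-1, j] is relevant). *)
Definition fpt (X Y : nat -> topologicalType) : Type :=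
  ({i : nat & X i} + {j : nat & (Y j * R)%type})%type.

Definition fpt_valid (n : nat) (X Y : nat -> topologicalType) (u : fpt X Y) : Prop :=
  match u with
  | inl (existT i _) => (i <= n)%N
  | inr (existT j (_, t)) => (1 <= j <= n)%N /\ j%:R - 1 <= t <= j%:R
  end.
Arguments fpt_valid n {X Y}.

(* The point of the A_i to which a point of the disjoint sum is glued, if any:
   a in A_i is glued to itself; (y, j-1) in Y_j x {j-1} to \overline{f_(j-1)} y;
   (y, j) in Y_j x {j} to \underline{f_j} y. *)
Definition fpt_anchor (X Y : nat -> topologicalType) (A : forall i, set (X i))
  (fl : forall i, Y i -> X i) (fu : forall i, Y i.+1 -> X i) (u : fpt X Y) :
  option {i : nat & X i} :=
  match u with
  | inl (existT i a) => if `[< A i a >] then Some (existT X i a) else None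
  | inr (existT j (y, t)) =>
      if `[< t = j%:R >] then Some (existT X j (fl j y))
      else if `[< t = j%:R - 1 >] then
        match j as j0 return Y j0 -> option {i : nat & X i} with
        | 0 => fun _ => None
        | j'.+1 => fun y' => Some (existT X j' (fu j' y'))
        end y
      else None
  end.
Arguments fpt_anchor {X Y}.

(* Z is (homeomorphic to) the quotient space X_0(Y_1)X_1...(Y_n)X_n determined
   by the pairs (X_i, A_i), the spaces Y_j, the maps fl i = \underline{f_i}
   (Y_i x {i} -> A_i, for 1 <= i <= n) and fu i = \overline{f_i}
   (Y_(i+1) x {i} -> A_i, for 0 <= i <= n-1); q is the quotient map. *)
Definition fibrous_decomposition (Z : topologicalType) (n : nat)
  (X Y : nat -> topologicalType) (A : forall i, set (X i))
  (fl : forall i, Y i -> X i) (fu : forall i, Y i.+1 -> X i) : Prop :=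
  (forall i, (i <= n)%N -> hausdorff_space (X i)) /\
  (forall j, (1 <= j <= n)%N -> hausdorff_space (Y j)) /\
  (forall i, (1 <= i <= n)%N -> continuous (fl i) /\ range (fl i) = A i) /\
  (forall i, (i < n)%N -> continuous (fu i) /\ range (fu i) = A i) /\
  exists (qX : forall i, X i -> Z) (qY : forall j, Y j -> R -> Z),
    let q (u : fpt X Y) : Z :=
      match u with
      | inl (existT i a) => qX i a
      | inr (existT j (y, t)) => qY j y t
      end in
    (forall z : Z, exists u, fpt_valid n u /\ q u = z) /\
    (forall u v, fpt_valid n u -> fpt_valid n v ->
       (q u = q v <-> u = v \/
          exists w, fpt_anchor A fl fu u = Some w /\ fpt_anchor A fl fu v = Some w)) /\
    (* Z carries the quotient topology of the disjoint sum of the X_i and the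
       Y_j x [j-1, j] *)
    (forall U : set Z, open U <->
       ((forall i, (i <= n)%N -> open (qX i @^-1` U)) /\
        (forall j, (1 <= j <= n)%N ->
           exists V : set (Y j * R)%type, open V /\
             V `&` [set p | j%:R - 1 <= p.2 <= j%:R] =
             (fun p => qY j p.1 p.2) @^-1` U `&` [set p | j%:R - 1 <= p.2 <= j%:R]))).

Inductive fibrous : nat -> topologicalType -> Prop :=
| fibrous0 (Z : topologicalType) :
    hausdorff_space Z -> finite_set [set: Z] -> fibrous 0 Z
| fibrousS (m : nat) (Z : topologicalType) (n : nat)
    (X Y : nat -> topologicalType) (A : forall i, set (X i))
    (fl : forall i, Y i -> X i) (fu : forall i, Y i.+1 -> X i) :
    hausdorff_space Z ->
    fibrous_decomposition Z n X Y A fl fu ->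
    (forall i, (i <= n)%N -> exists k, (k <= m)%N /\ fibrous k (X i)) ->
    (forall j, (1 <= j <= n)%N -> exists k, (k <= m)%N /\ fibrous k (Y j)) ->
    fibrous m.+1 Z.

(* Main.v *)
(* The height function Z -> [0, n] sends the copy of X_i to i and (y, t) to t.
   The open sets U_i = {i - 1 < height < i + 1} and {j - 1 < height < j} retract
   by deformation, linearly in the second coordinate, onto the copies of X_i and
   of Y_j x {j - 1/2}.  As {height < k + 2} = {height < k + 1} U U_(k+1), the two
   sets meeting in {k < height < k + 1}, n applications of Mayer-Vietoris give
   the formula; finiteness of the homology follows by induction on m from the
   finite discrete spaces.

   Mayer-Vietoris and homotopy invariance are proved for the complex of singular
   chains of an ambient space, those of a subset being a subcomplex.  Prisms and
   barycentric subdivision come from one acyclic-model construction ([fill]) on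
   affine chains of Delta n x R: the filling of a natural chain map by cones from
   the barycenter has a [residue], which vanishes for the difference of the two
   ends of a cylinder and is the subdivision operator for a single end. *)

Require Import Defs.
From mathcomp.multinomials Require Import freeg.
From HB Require Import structures.
From mathcomp Require Import all_boot all_order all_algebra.
From mathcomp Require Import all_classical all_reals all_analysis.
From mathcomp Require Import Rstruct Rstruct_topology.
From mathcomp Require Import zify lra.
Import Order.TTheory GRing.Theory Num.Theory.
Import numFieldNormedType.Exports.
Local Open Scope classical_set_scope.
Local Open Scope ring_scope.
Set Implicit Arguments.
Unset Strict Implicit.
Unset Printing Implicit Defensive.

(** * Dimensions of subquotients *)

Section Subquotients.
Variable F : fieldType.
Implicit Types (V W : lmodType F) (d : nat).

(** Three choices shape the argument. Homology is never formed as a quotient: [qdim] speaks of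
    cycles modulo boundaries inside one chain module of the ambient space, so intersections and sums
    of subcomplexes are literal and an isomorphism may be given as a relation. Mayer-Vietoris is
    used only from two open sets and their intersection to the union, so finiteness propagates from
    the pieces to [Z]. The delicate topological point is continuity of a homotopy on a quotient,
    which involves the product of a quotient map with the real line; compactness of time intervals
    supplies it. For [m = 0] the fibers carry no hypothesis: there the finiteness of [Z] must force
    each [X_i] to be finite and each [Y_j] to be empty, because one point of [Y_j] would put a whole
    interval into [Z]. *)

Definition lin_closed V (S : set V) :=
  S 0 /\ forall a u v, S u -> S v -> S (a *: u + v).

Lemma lin_closedD V (S : set V) u v : lin_closed S -> S u -> S v -> S (u + v).
Proof. by move=> [_ h] hu hv; rewrite -[u]scale1r; exact: h. Qed.

Lemma lin_closedZ V (S : set V) a u : lin_closed S -> S u -> S (a *: u).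
Proof. by move=> [h0 h] hu; rewrite -[_ *: _]addr0; exact: h. Qed.

Lemma lin_closedN V (S : set V) u : lin_closed S -> S u -> S (- u).
Proof. by move=> hS hu; rewrite -scaleN1r; exact: lin_closedZ. Qed.

Lemma lin_closedB V (S : set V) u v : lin_closed S -> S u -> S v -> S (u - v).
Proof. by move=> hS hu hv; apply: lin_closedD => //; exact: lin_closedN. Qed.

Lemma lin_closed_sum V (S : set V) (I : Type) (r : seq I) (P : pred I) (f : I -> V) :
  lin_closed S -> (forall i, P i -> S (f i)) -> S (\sum_(i <- r | P i) f i).
Proof.
move=> hS hf; elim/big_ind: _ => //; first by case: hS.
by move=> u v hu hv; exact: lin_closedD.
Qed.

(** Serves both for coordinates in a homology group and, over the reals, as the point with
    barycentric coordinates [a] in the affine simplex with vertices [z]. *)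
Definition comb V d (a : 'rV[F]_d) (z : 'I_d -> V) : V := \sum_k a 0 k *: z k.

Lemma comb_linear V d (z : 'I_d -> V) c a b :
  comb (c *: a + b) z = c *: comb a z + comb b z.
Proof.
rewrite /comb scaler_sumr -big_split /=; apply: eq_bigr => k _.
by rewrite !mxE scalerDl scalerA.
Qed.

Lemma combD V d (z : 'I_d -> V) a b : comb (a + b) z = comb a z + comb b z.
Proof. by rewrite -[a]scale1r comb_linear !scale1r. Qed.

Lemma comb0 V d (z : 'I_d -> V) : comb 0 z = 0.
Proof. by rewrite /comb big1 // => k _; rewrite mxE scale0r. Qed.

Lemma comb_mul V d e (a : 'rV[F]_d) (M : 'M[F]_(d, e)) (z : 'I_e -> V) :
  comb (a *m M) z = comb a (fun i => comb (row i M) z).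
Proof.
rewrite /comb; under eq_bigr do rewrite mxE scaler_suml.
rewrite exchange_big; apply: eq_bigr => i _ /=.
by rewrite scaler_sumr; apply: eq_bigr => j _; rewrite !mxE scalerA.
Qed.

Lemma combB_mem V d (S : set V) (a : 'rV[F]_d) (z z' : 'I_d -> V) :
  lin_closed S -> (forall k, S (z k - z' k)) -> S (comb a z - comb a z').
Proof.
move=> hS h; rewrite /comb -sumrB; apply: lin_closed_sum => // k _.
by rewrite -scalerBr; exact: lin_closedZ.
Qed.

Lemma comb_mem V d (S : set V) (a : 'rV[F]_d) (z : 'I_d -> V) :
  lin_closed S -> (forall k, S (z k)) -> S (comb a z).
Proof. by move=> hS h; apply: lin_closed_sum => // k _; exact: lin_closedZ. Qed.

Lemma comb_row_mx V d e (a : 'rV[F]_(d + e)) (z : 'I_d -> V) (z' : 'I_e -> V) :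
  comb a (fun k => match fintype.split k with inl i => z i | inr j => z' j end) =
  comb (lsubmx a) z + comb (rsubmx a) z'.
Proof.
rewrite /comb big_split_ord /=; congr (_ + _); apply: eq_bigr => i _.
  by rewrite (unsplitK (inl i)) mxE.
by rewrite (unsplitK (inr i)) mxE.
Qed.

(* The subquotient Z / B has dimension d, without reference to the quotient. *)
Definition qdim V (Z B : set V) d := exists z : 'I_d -> V,
  [/\ forall k, Z (z k), forall c, Z c -> exists a, B (c - comb a z)
    & forall a, B (comb a z) -> a = 0].

(** Writing the basis in terms of [z'] modulo [B] gives a matrix [M]; a row vector killed by [M]
    yields a combination of the basis in [B], hence is zero. So [M] is row free and has at least [d]
    columns. *)
Lemma qdim_min V (Z B : set V) d d' (z' : 'I_d' -> V) : lin_closed B ->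
  qdim Z B d -> (forall c, Z c -> exists a, B (c - comb a z')) -> (d <= d')%N.
Proof.
move=> hB [z [hz _ zfree]] hz'.
have [m hm] := choice (fun k => hz' _ (hz k)).
pose M := \matrix_(k < d) m k.
suff /eqP <- : row_free M by exact: rank_leq_col.
rewrite -kermx_eq0; apply/rowV0P => a /sub_kermxP aM0.
apply: zfree; rewrite -[comb a z]subr0 -[X in _ - X](comb0 z') -aM0 comb_mul.
by apply: combB_mem => // k; rewrite rowK.
Qed.

Lemma qdim_unique V (Z B : set V) d d' : lin_closed B ->
  qdim Z B d -> qdim Z B d' -> d = d'.
Proof.
move=> hB h h'; apply/eqP; rewrite eqn_leq.
have [z [_ hz _]] := h; have [z' [_ hz' _]] := h'.
by rewrite (qdim_min hB h hz') (qdim_min hB h' hz).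
Qed.

(** A linear correspondence, total on both sides and matching [B] with [B'], is an isomorphism of
    subquotients. Relations suit maps that exist only up to boundaries, such as the connecting
    homomorphism. *)
Lemma qdim_rel V W (Z B : set V) (Z' B' : set W) (r : V -> W -> Prop) d :
  lin_closed Z -> lin_closed Z' ->
  (forall c u v u' v', r u u' -> r v v' -> r (c *: u + v) (c *: u' + v')) ->
  r 0 0 ->
  (forall u, Z u -> exists2 u', Z' u' & r u u') ->
  (forall u', Z' u' -> exists2 u, Z u & r u u') ->
  (forall u u', Z u -> Z' u' -> r u u' -> (B u <-> B' u')) ->
  qdim Z B d -> qdim Z' B' d.
Proof.
move=> hZ hZ' hr r0 rl rr rB [z [Zz zspan zfree]].
have [z' hz'] := choice (fun k => (let: ex_intro2 u' h1 h2 := rl _ (Zz k)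
   in ex_intro _ u' (conj h1 h2)) : exists u', Z' u' /\ r (z k) u').
have rcomb a : r (comb a z) (comb a z').
  rewrite /comb; elim/big_ind2: _ => //.
    by move=> x1 x2 y1 y2 h1 h2; rewrite -[x1]scale1r -[x2]scale1r; exact: hr.
  move=> i _; rewrite -[_ *: z i]addr0 -[_ *: z' i]addr0; apply: hr => //.
  by case: (hz' i).
have Zc a : Z (comb a z) by exact: comb_mem.
have Z'c a : Z' (comb a z') by apply: comb_mem => // k; case: (hz' k).
exists z'; split; first by move=> k; case: (hz' k).
  move=> c' Zc'; have [c Zc0 rc] := rr _ Zc'.
  have [a Ba] := zspan _ Zc0; exists a.
  apply/(rB (c - comb a z)) => //; [exact: lin_closedB|exact: lin_closedB|].
  rewrite ![_ - comb a _]addrC -[- comb a z]scaleN1r -[- comb a z']scaleN1r.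
  exact: hr.
by move=> a Ba; apply: zfree; apply/(rB _ (comb a z')).
Qed.

(** Among the matrices with row space in [P] take one of maximal rank; a vector of [P] outside its
    row space would increase the rank. *)
Lemma lin_closed_rV d (P : set 'rV[F]_d) : lin_closed P ->
  exists A : 'M[F]_d, forall v, P v <-> (v <= A)%MS.
Proof.
move=> hP.
pose good r := `[< exists A : 'M[F]_d, \rank A = r /\ forall v, (v <= A)%MS -> P v >].
have ex0 : exists r, good r.
  exists 0%N; apply/asboolP; exists 0; rewrite mxrank0; split => // v.
  by rewrite submx0 => /eqP ->; case: hP.
have ub r : good r -> (r <= d)%N by move=> /asboolP [A [<- _]]; exact: rank_leq_row.
have [r /asboolP [A [rA AP]] rmax] := ex_maxnP ex0 ub.
exists A => v; split; last exact: AP.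
move=> Pv; apply: contrapT => /negP nvA.
have /rmax : good (\rank (A + v)%MS).
  apply/asboolP; exists (A + v)%MS; split => // w /sub_addsmxP [[w1 w2] /= ->].
  apply: lin_closedD => //; first by apply: AP; exact: submxMl.
  by rewrite [w2]mx11_scalar mul_scalar_mx; exact: lin_closedZ.
rewrite leqNgt -rA => /negP; apply.
have : (A < A + v)%MS.
  by rewrite /ltmx addsmxSl /=; apply: contra nvA; apply: submx_trans; exact: addsmxSr.
by rewrite ltmxErank => /andP [].
Qed.

(** In coordinates for [Z / B], the combinations lying in [M] form the row space of a matrix [A].
    Its row basis gives [M / B], that of a complement gives [Z / M]. *)
Lemma qdim_split V (Z M B : set V) d :
  lin_closed Z -> lin_closed M -> lin_closed B -> B `<=` M -> M `<=` Z ->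
  qdim Z B d -> exists d1 d2, [/\ qdim Z M d1, qdim M B d2 & d = (d1 + d2)%N].
Proof.
move=> hZ hM hB BM MZ [z [Zz zspan zfree]].
have [|A hA] := @lin_closed_rV d [set a | M (comb a z)].
  split => /=; first by rewrite comb0; case: hM.
  by move=> c u v hu hv; rewrite comb_linear; case: hM => _; apply.
exists (\rank A^C), (\rank A); split; last by rewrite mxrank_compl subnK ?rank_leq_row.
- exists (fun k => comb (row k (row_base A^C%MS)) z); split.
  + by move=> k; exact: comb_mem.
  + move=> c Zc; have [a Ba] := zspan c Zc.
    have : (a <= A + A^C)%MS by rewrite submx_full // addsmx_compl_full.
    case/sub_addsmxP => -[u1 u2] /= ea.
    have : (u2 *m A^C <= row_base A^C)%MS by rewrite eq_row_base submxMl.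
    case/submxP => D eD; exists D; rewrite -comb_mul -eD.
    have -> : c - comb (u2 *m A^C%MS) z = (c - comb a z) + comb (u1 *m A) z.
      by rewrite ea combD opprD addrA addrAC subrK.
    by apply: lin_closedD => //; [exact: BM | apply/hA; exact: submxMl].
  + move=> D; rewrite -comb_mul => /hA DA.
    have : (D *m row_base A^C%MS <= A :&: A^C)%MS.
      by rewrite sub_capmx DA /= -(eq_row_base A^C%MS) submxMl.
    rewrite capmx_compl submx0 => /eqP D0.
    by apply: (row_free_inj (row_base_free A^C%MS)); rewrite mul0mx.
- exists (fun k => comb (row k (row_base A)) z); split.
  + by move=> k; apply/hA; rewrite -(eq_row_base A) row_sub.
  + move=> c Mc; have [a Ba] := zspan c (MZ _ Mc).
    have : (a <= row_base A)%MS.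
      rewrite eq_row_base; apply/hA => /=.
      have -> : comb a z = c - (c - comb a z) by rewrite subKr.
      by apply: lin_closedB => //; exact: BM.
    by case/submxP => D eD; exists D; rewrite -comb_mul -eD.
  + move=> D; rewrite -comb_mul => /zfree D0.
    by apply: (row_free_inj (row_base_free A)); rewrite mul0mx.
Qed.

Lemma qdim_add V (Z M B : set V) d1 d2 :
  lin_closed Z -> lin_closed M -> lin_closed B -> B `<=` M -> M `<=` Z ->
  qdim Z M d1 -> qdim M B d2 -> qdim Z B (d1 + d2).
Proof.
move=> hZ hM hB BM MZ [z [Zz zspan zfree]] [y [My yspan yfree]].
exists (fun k => match fintype.split k with inl i => z i | inr j => y j end); split.
- by move=> k; case: (fintype.split k) => // j; exact: MZ.
- move=> c Zc; have [a Ma] := zspan c Zc; have [b Bb] := yspan _ Ma.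
  by exists (row_mx a b); rewrite comb_row_mx row_mxKl row_mxKr opprD addrA.
- move=> a; rewrite comb_row_mx => Ba.
  have l0 : lsubmx a = 0.
    apply: zfree; rewrite -[comb _ _](addrK (comb (rsubmx a) y)).
    by apply: lin_closedB => //; [exact: BM | exact: comb_mem].
  rewrite -[a]hsubmxK l0; move: Ba; rewrite l0 comb0 add0r => /yfree ->.
  by rewrite row_mx0.
Qed.

Lemma qdim_prod V W (Z B : set V) (Z' B' : set W) d d' :
  lin_closed B -> lin_closed B' -> Z 0 -> Z' 0 ->
  qdim Z B d -> qdim Z' B' d' ->
  qdim [set u : V * W | Z u.1 /\ Z' u.2] [set u | B u.1 /\ B' u.2] (d + d').
Proof.
move=> hB hB' Z0 Z'0 [z [Zz zspan zfree]] [y [Zy yspan yfree]].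
exists (fun k => match fintype.split k with inl i => (z i, 0) | inr j => (0, y j) end).
have cE a : comb a (fun k => match fintype.split k with inl i => (z i, 0) | inr j => (0, y j) end) =
    (comb (lsubmx a) z, comb (rsubmx a) y).
  rewrite comb_row_mx; apply: injective_projections; rewrite /= /comb !raddf_sum /=.
    by rewrite [X in _ + X]big1 ?addr0 // => i _; rewrite scaler0.
  by rewrite [X in X + _]big1 ?add0r // => i _; rewrite scaler0.
split.
- by move=> k; case: (fintype.split k) => i; split => /=.
- move=> [c c'] /= [Zc Zc']; have [a Ba] := zspan _ Zc; have [b Bb] := yspan _ Zc'.
  by exists (row_mx a b); rewrite cE row_mxKl row_mxKr.
- move=> a; rewrite cE /= => -[/zfree l0 /yfree r0].
  by rewrite -[a]hsubmxK l0 r0 row_mx0.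
Qed.

Lemma qdim0 V (Z B : set V) : Z `<=` B -> qdim Z B 0.
Proof.
move=> ZB; exists (fun _ => 0); split; first by case.
  by move=> c /ZB Bc; exists 0; rewrite comb0 subr0.
by move=> a _; apply/rowP; case.
Qed.

End Subquotients.

(** * Mayer-Vietoris for two subcomplexes *)

Section MayerVietoris.
Variables (F : fieldType) (V : nat -> lmodType F).
Variable bd : forall n, {linear V n.+1 -> V n}.
Hypothesis bd_bd : forall n c, bd n (bd n.+1 c) = 0.

Definition subcomplex (S : forall n, set (V n)) :=
  (forall n, lin_closed (S n)) /\ (forall n c, S n.+1 c -> S n (bd n c)).

Definition is_cyc n : V n -> Prop :=
  match n return V n -> Prop with 0 => fun _ => True | n'.+1 => fun c => bd n' c = 0 end.

Definition cyc (S : forall n, set (V n)) n : set (V n) :=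
  [set c | S n c /\ is_cyc c].

Arguments cyc : clear implicits.

Definition bnd (S : forall n, set (V n)) n : set (V n) :=
  [set c | exists2 b, S n.+1 b & c = bd n b].

Arguments bnd : clear implicits.

Definition hdimc S n d := qdim (cyc S n) (bnd S n) d.

Definition euler S (e : int) := exists N (ds : nat -> nat),
  [/\ forall n, hdimc S n (ds n), forall n, (N <= n)%N -> ds n = 0%N
    & e = \sum_(k < N) (-1) ^+ k * (ds k)%:Z].

Lemma lin_closed_is_cyc n : lin_closed [set c : V n | is_cyc c].
Proof.
case: n => [|n]; first by [].
split => /=; first by rewrite linear0.
by move=> a u v hu hv; rewrite linearP /= hu hv scaler0 addr0.
Qed.

Lemma lin_closed_cyc S n : subcomplex S -> lin_closed (cyc S n).
Proof.
move=> [hS _]; have [c0 cl] := lin_closed_is_cyc n; have [s0 sl] := hS n.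
by split; [split | move=> a u v [? ?] [? ?]; split; [exact: sl | exact: cl]].
Qed.

Lemma lin_closed_bnd S n : subcomplex S -> lin_closed (bnd S n).
Proof.
move=> [hS _]; have [s0 sl] := hS n.+1.
split; first by exists 0; rewrite ?linear0.
by move=> a u v [b Sb ->] [b' Sb' ->]; exists (a *: b + b'); [exact: sl | rewrite linearP].
Qed.

Lemma bnd_is_cyc n b : is_cyc (bd n b).
Proof. by case: n b => [|n] b //=; exact: bd_bd. Qed.

Lemma bnd_cyc S n : subcomplex S -> bnd S n `<=` cyc S n.
Proof. by move=> [_ hS] c [b Sb ->]; split; [exact: hS | exact: bnd_is_cyc]. Qed.

Lemma euler_sum_widen (ds : nat -> nat) N N' : (forall n, (N <= n)%N -> ds n = 0%N) ->
  (N <= N')%N -> \sum_(k < N) (-1) ^+ k * (ds k)%:Z = \sum_(k < N') (-1) ^+ k * (ds k)%:Z :> int.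
Proof.
move=> h NN'; rewrite -!(big_mkord xpredT (fun k => (-1) ^+ k * (ds k)%:Z : int)).
rewrite [RHS](big_cat_nat (n := N)) //= [X in _ + X]big_nat_cond [X in _ + X]big1 ?addr0 //.
by move=> k; rewrite andbT => /andP [/h -> _]; rewrite mulr0.
Qed.

Section TwoSubcomplexes.
Local Unset Implicit Arguments.
Variables A B : forall n, set (V n).
Hypotheses (hA : subcomplex A) (hB : subcomplex B).
Let AB n := A n `&` B n.
Let S n : set (V n) := [set c | exists a b, [/\ A n a, B n b & c = a + b]].

Lemma subcomplexI : subcomplex AB.
Proof.
have [Al Ab] := hA; have [Bl Bb] := hB; split => n; last first.
  by move=> c [? ?]; split; [exact: Ab | exact: Bb].
have [a0 al] := Al n; have [b0 bl] := Bl n.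
by split; [split | move=> a u v [? ?] [? ?]; split; [exact: al | exact: bl]].
Qed.

Lemma subcomplexD : subcomplex S.
Proof.
have [Al Ab] := hA; have [Bl Bb] := hB; split => n; last first.
  by move=> _ [a [b [Aa Bb' ->]]]; exists (bd n a), (bd n b); rewrite linearD; split; auto.
have [a0 al] := Al n; have [b0 bl] := Bl n.
split; first by exists 0, 0; rewrite addr0.
move=> c _ _ [a [b [Aa Bb1 ->]]] [a' [b' [Aa' Bb' ->]]].
exists (c *: a + a'), (c *: b + b'); split; [exact: al|exact: bl|].
by rewrite scalerDr addrACA.
Qed.

Let ZZ n : set (V n * V n) := [set u | cyc A n u.1 /\ cyc B n u.2].
Let BB n : set (V n * V n) := [set u | bnd A n u.1 /\ bnd B n u.2].
(* K, I, J are the kernels and images along the Mayer-Vietoris sequence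
   H(AB) -> H(A) (+) H(B) -> H(S) -> H(AB)[-1], as subspaces of cycles: exactness
   becomes cyc AB / K = I / BB, ZZ / I = J / bnd S and cyc S / J = K / bnd AB
   (one degree lower). *)
Let K n := cyc AB n `&` (bnd A n `&` bnd B n).
Let I n : set (V n * V n) := ZZ n `&` [set u | bnd S n (u.1 + u.2)].
Let J n : set (V n) := [set c | exists a b, [/\ cyc A n a, cyc B n b & c = a + b]].

Let lin_setI (W : lmodType F) (P Q : set W) :
  lin_closed P -> lin_closed Q -> lin_closed (P `&` Q).
Proof.
move=> [p0 pl] [q0 ql]; split; first by split.
by move=> a u v [? ?] [? ?]; split; [exact: pl | exact: ql].
Qed.

Let lin_prod (W W' : lmodType F) (P : set W) (Q : set W') : lin_closed P -> lin_closed Q ->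
  lin_closed [set u : W * W' | P u.1 /\ Q u.2].
Proof.
move=> [p0 pl] [q0 ql]; split; first by split.
by move=> a u v [? ?] [? ?]; split; [exact: pl | exact: ql].
Qed.

Let linZA n := lin_closed_cyc n hA.
Let linZB n := lin_closed_cyc n hB.
Let linZAB n := lin_closed_cyc n subcomplexI.
Let linZS n := lin_closed_cyc n subcomplexD.
Let linBA n := lin_closed_bnd n hA.
Let linBB n := lin_closed_bnd n hB.
Let linBAB n := lin_closed_bnd n subcomplexI.
Let linBS n := lin_closed_bnd n subcomplexD.
Let linK n : lin_closed (K n).
Proof. by apply: lin_setI => //; exact: lin_setI. Qed.
Let linZZ n : lin_closed (ZZ n).
Proof. exact: lin_prod. Qed.
Let linBB2 n : lin_closed (BB n).
Proof. exact: lin_prod. Qed.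
Let linI n : lin_closed (I n).
Proof.
apply: lin_setI => //; have [s0 sl] := linBS n; split => /=; first by rewrite addr0.
by move=> a u v hu hv /=; rewrite addrACA -scalerDr; exact: sl.
Qed.
Let linJ n : lin_closed (J n).
Proof.
have [a0 al] := linZA n; have [b0 bl] := linZB n.
split; first by exists 0, 0; rewrite addr0.
move=> c _ _ [a [b [Aa Bb1 ->]]] [a' [b' [Aa' Bb' ->]]].
exists (c *: a + a'), (c *: b + b'); split; [exact: al|exact: bl|].
by rewrite scalerDr addrACA.
Qed.

(** The isomorphism sends [c] to [(c, - c)]. It is onto because [a + b = bd (a' + b')] can be
    rearranged: [a - bd a' = bd b' - b] lies in both [A] and [B]. *)
Let qdim_KI n d : qdim (cyc AB n) (K n) d -> qdim (I n) (BB n) d.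
Proof.
apply: (@qdim_rel _ _ _ _ _ _ _ (fun c u => BB n (u.1 - c, u.2 + c))) => //.
- move=> c u v [u1 u2] [v1 v2] /= hu hv.
  have := (linBB2 n).2 c _ _ hu hv; congr (BB n); apply: injective_projections => /=.
    by rewrite scalerBr opprD addrACA.
  by rewrite scalerDr addrACA.
- by rewrite /= subr0 addr0; case: (linBB2 n).
- move=> c [[Ac Bc] cc]; exists (c, - c); last first.
    by rewrite /= subrr addNr; case: (linBB2 n).
  split; last by rewrite /= subrr; case: (linBS n).
  by split; split => //=; [apply: lin_closedN => //;
      case: hB | apply: (lin_closedN (lin_closed_is_cyc n))].
- move=> [a b] [[/= [Aa ca] [Bb cb]] [_ [a' [b' [Aa' Bb' ->]]]]].
  rewrite linearD => abE.
  have cE : a - bd n a' = bd n b' - b.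
    by apply/eqP; rewrite subr_eq addrAC [bd n b' + _]addrC -abE addrK.
  exists (a - bd n a'); last first.
    split; rewrite /=; first by rewrite subKr; exists a'.
    by rewrite cE addrC subrK; exists b'.
  split; last by apply: (lin_closedB (lin_closed_is_cyc n)) => //; exact: bnd_is_cyc.
  split; first by apply: lin_closedB => //; [case: hA | case: hA => _; exact].
  by rewrite cE; apply: lin_closedB => //; [case: hB | case: hB => _; exact].
- move=> c [a b] Zc _ [/= ha hb]; split.
    move=> [_ [hc hc']]; split => /=.
      by rewrite -(subrK c a); exact: lin_closedD.
    by rewrite -(addrK c b); exact: lin_closedB.
  move=> [/= ha' hb']; split => //; split.
    by rewrite -[c](subKr a); exact: lin_closedB.
  by rewrite -[c](addKr b) addrC; exact: lin_closedB.
Qed.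

Let qdim_IJ n d : qdim (ZZ n) (I n) d -> qdim (J n) (bnd S n) d.
Proof.
apply: (@qdim_rel _ _ _ _ _ _ _ (fun u c => c = u.1 + u.2)) => //.
- by move=> c u v _ _ -> -> /=; rewrite scalerDr addrACA.
- by rewrite /= addr0.
- by move=> [a b] [/= Za Zb]; exists (a + b) => //; exists a, b.
- by move=> _ [a [b [Za Zb ->]]]; exists (a, b).
- by move=> u c Zu _ ->; split => [[]|].
Qed.

(** The connecting homomorphism read backwards: a cycle [c] bounding [a] in [A] and [b] in [B]
    corresponds to the cycle [a - b] of [S] one degree up. The freedom in [a] and [b] is why a
    relation is used. *)
Let qdim_KJ n d : qdim (K n) (bnd AB n) d -> qdim (cyc S n.+1) (J n.+1) d.
Proof.
apply: (@qdim_rel _ _ _ _ _ _ _ (fun c z => exists a b,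
   [/\ A n.+1 a, B n.+1 b, z = a - b, c = bd n a & c = bd n b])) => //.
- move=> c _ _ _ _ [a [b [Aa Bb -> -> e]]] [a' [b' [Aa' Bb' -> -> e']]].
  exists (c *: a + a'), (c *: b + b'); split.
  + exact: (hA.1 n.+1).2.
  + exact: (hB.1 n.+1).2.
  + by rewrite scalerBr opprD addrACA.
  + by rewrite linearP.
  + by rewrite linearP /= e e'.
- exists 0, 0; rewrite subr0 linear0; split => //.
    exact: (hA.1 n.+1).1.
  exact: (hB.1 n.+1).1.
- move=> c [Zc [[a Aa ca] [b Bb cb]]]; exists (a - b); last by exists a, b.
  split; last by rewrite /= linearB -ca -cb subrr.
  exists a, (- b); split => //; apply: lin_closedN => //; by case: hB.
- move=> _ [[a [b [Aa Bb ->]]]] /=; rewrite linearD => /eqP; rewrite addr_eq0 => /eqP e.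
  exists (bd n a); last first.
    exists a, (- b); rewrite opprK linearN; split => //.
    by apply: lin_closedN => //; case: hB.
  split; last by split; [exists a | exists (- b); rewrite ?linearN //;
      apply: lin_closedN => //; case: hB].
  split; last exact: bnd_is_cyc.
  split; first by case: hA => _; exact.
  by rewrite e -linearN; case: hB => hB1 hB2; apply: hB2; exact: lin_closedN.
- move=> c z Kc [Sz cz] [a [b [Aa Bb ez ea eb]]]; split.
    move=> [w [Aw Bw] cw]; exists (a - w), (w - b); split.
    + split; last by rewrite /= linearB -ea -cw subrr.
      by apply: lin_closedB => //; case: hA.
    + split; last by rewrite /= linearB -eb -cw subrr.
      by apply: lin_closedB => //; case: hB.
    + by rewrite addrA subrK.
  move=> [a' [b' [[Aa' ca'] [Bb' cb'] e]]].
  have aE : a - a' = b + b'.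
    by apply/eqP; rewrite subr_eq addrAC [b + _]addrC -addrA [b + _]addrC addrA -e ez subrK.
  exists (a - a'); last by rewrite linearB /= [bd n a']ca' subr0.
  split; first by apply: lin_closedB => //; case: hA.
  by rewrite aE; apply: lin_closedD => //; case: hB.
Qed.

(** With [p], [q], [r] the dimensions of the graded pieces, the homology of [AB], of [A] and [B]
    together, and of [S] has dimension [q n + p n], [r n + q n] and [r n + p (n - 1)]. In the
    alternating sum the shifted [p] changes sign, and the identity then holds degree by degree. *)
Lemma euler_mayer_vietoris eA eB eAB :
  euler A eA -> euler B eB -> euler AB eAB -> euler S (eA + eB - eAB).
Proof.
move=> [NA [dA [hdA dA0 ->]]] [NB [dB [hdB dB0 ->]]] [NI [dI [hdI dI0 ->]]].
have h1 n : exists pq : nat * nat,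
    [/\ qdim (K n) (bnd AB n) pq.1, qdim (cyc AB n) (K n) pq.2 & dI n = (pq.2 + pq.1)%N].
  have [||q [p [hq hp e]]] := qdim_split (linZAB n) (linK n) (linBAB n) _ _ (hdI n).
  - move=> c hc; split; first exact: (bnd_cyc subcomplexI).
    by case: hc => b [Ab Bb] ->; split; exists b.
  - by move=> c [].
  by exists (p, q).
have [pq hpq] := choice h1.
pose p n := (pq n).1; pose q n := (pq n).2.
have h2 n : exists r, qdim (ZZ n) (I n) r /\ (dA n + dB n)%N = (r + q n)%N.
  have hZB := qdim_prod (linBA n) (linBB n) (linZA n).1 (linZB n).1 (hdA n) (hdB n).
  have [||r [q' [hr hq' e]]] := qdim_split (linZZ n) (linI n) (linBB2 n) _ _ hZB.
  - move=> [a b] [/= ha hb]; split; first by split; exact: bnd_cyc.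
    case: ha => a' Aa' ->; case: hb => b' Bb' -> /=; exists (a' + b'); last by rewrite linearD.
    by exists a', b'.
  - by move=> u [].
  exists r; split => //; rewrite e; congr (_ + _)%N.
  apply: (qdim_unique (linBB2 n) hq'); apply: qdim_KI.
  by case: (hpq n).
have [r hr] := choice h2.
pose ds n := (r n + (if n is n'.+1 then p n' else 0))%N.
pose N := maxn NA (maxn NB NI).
have NAN : (NA <= N)%N by rewrite leq_max leqnn.
have NBN : (NB <= N)%N by rewrite !leq_max leqnn orbT.
have NIN : (NI <= N)%N by rewrite !leq_max leqnn !orbT.
have p0 n : (N <= n)%N -> p n = 0%N.
  move=> Nn; have [_ _] := hpq n; rewrite dI0 ?(leq_trans NIN) //.
  by move/esym/eqP; rewrite addn_eq0 => /andP [_ /eqP].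
have q0 n : (N <= n)%N -> q n = 0%N.
  move=> Nn; have [_ _] := hpq n; rewrite dI0 ?(leq_trans NIN) //.
  by move/esym/eqP; rewrite addn_eq0 => /andP [/eqP h _].
have r0 n : (N <= n)%N -> r n = 0%N.
  move=> Nn; have [_] := hr n; rewrite dA0 ?(leq_trans NAN) // dB0 ?(leq_trans NBN) //.
  by move/esym/eqP; rewrite addn_eq0 => /andP [/eqP h _].
(* The shift of [p] can leave homology of [S] in degree [N], one beyond what the common bound allows
   for the other three. *)
exists N.+1, ds; split.
- move=> n; have [hrn _] := hr n; have hJ := qdim_IJ _ _ hrn.
  case: n hrn hJ => [|n] hrn hJ; rewrite /ds.
    rewrite addn0 /hdimc.
    have -> // : cyc S 0 = J 0.
    rewrite eqEsubset; split => c.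
      by move=> [[a [b [Aa Bb ->]]] _]; exists a, b.
    by move=> [a [b [[Aa _] [Bb _] ->]]]; split => //; exists a, b.
  rewrite addnC; apply: (qdim_add (M := J n.+1)) => //.
  + move=> _ [_ [a [b [Aa Bb ->]]] ->]; exists (bd _ a), (bd _ b); rewrite linearD; split => //.
      by apply: bnd_cyc => //; exists a.
    by apply: bnd_cyc => //; exists b.
  + move=> _ [a [b [[Aa ca] [Bb cb] ->]]]; split; first by exists a, b.
    exact: (lin_closedD (lin_closed_is_cyc n.+1)).
  + by apply: qdim_KJ; case: (hpq n).
- case=> // n Nn; rewrite /ds r0 ?(leq_trans _ Nn) // p0 //.
- rewrite (euler_sum_widen dA0 NAN) (euler_sum_widen dB0 NBN) (euler_sum_widen dI0 NIN).
  have E1 : \sum_(k < N.+1) (-1) ^+ k * (if val k is k'.+1 then p k' else 0%N)%:Z =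
      - \sum_(k < N) (-1) ^+ k * (p k)%:Z :> int.
    rewrite big_ord_recl /= mulr0 add0r -sumrN; apply: eq_bigr => k _.
    by rewrite exprS mulN1r mulNr.
  have E2 : \sum_(k < N.+1) (-1) ^+ k * (r k)%:Z = \sum_(k < N) (-1) ^+ k * (r k)%:Z :> int.
    by rewrite big_ord_recr /= r0 // mulr0 addr0.
  rewrite /ds; under [RHS]eq_bigr do rewrite PoszD mulrDr.
  rewrite big_split /= E1 E2 -big_split /= -!sumrB; apply: eq_bigr => k _.
  rewrite -mulrDr -!mulrBr; congr (_ * _).
  have [_] := hr k; have [_ _] := hpq k; rewrite -/(p k) -/(q k); lia.
Qed.

End TwoSubcomplexes.
End MayerVietoris.
Arguments cyc {F V} bd S n _.
Arguments bnd {F V} bd S n _.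

(** * Affine and singular chains *)

Section FreeModule.
Variables (F : fieldType) (K : choiceType).
Implicit Types (M : lmodType F) (P : set K).

HB.instance Definition _ M (f : K -> M) :=
  GRing.isZmodMorphism.Build {freeg K / F} M (fglift f) (lift_is_additive f).

Lemma fglift_sum M (f : K -> M) (c : {freeg K / F}) :
  fglift f c = \sum_(k <- dom c) coeff k c *: f k.
Proof.
rewrite -{1}[c]freeg_sumE raddf_sum; apply: eq_bigr => k _; exact: liftU.
Qed.

Lemma fglift_is_scalable M (f : K -> M) : scalable (fglift f).
Proof.
move=> a c; rewrite {1}/GRing.scale /= /fgscale raddf_sum fglift_sum scaler_sumr.
by apply: eq_bigr => k _; rewrite scalerA; exact: liftU.
Qed.

HB.instance Definition _ M (f : K -> M) :=
  GRing.isScalable.Build F {freeg K / F} M *:%R (fglift f) (fglift_is_scalable f).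

Definition lext M (f : K -> M) : {linear {freeg K / F} -> M} := fglift f.

Lemma lextU M (f : K -> M) k : lext f << k >> = f k.
Proof. by rewrite /lext /= liftU scale1r. Qed.

Definition supp_in P (c : {freeg K / F}) := forall k, coeff k c != 0 -> P k.

Lemma supp_inU P k : P k -> supp_in P << k >>.
Proof. by move=> Pk k'; rewrite coeffU mul1r; case: (eqVneq k k') => [<-|] //=; rewrite eqxx. Qed.

Lemma lin_closed_supp_in P : lin_closed (supp_in P).
Proof.
split => [k|a u v hu hv k]; first by rewrite coeff0 eqxx.
rewrite coeffD coeffZ; have [u0|/hu //] := eqVneq (coeff k u) 0.
by rewrite u0 mulr0 add0r => /hv.
Qed.

Lemma supp_in_ind P (S : set {freeg K / F}) c : lin_closed S ->
  (forall k, P k -> S << k >>) -> supp_in P c -> S c.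
Proof.
move=> hS hP hc; rewrite -[c]freeg_sumE big_seq; apply: lin_closed_sum => // k.
rewrite mem_dom => /hc /hP Sk.
suff -> : << coeff k c *g k >> = coeff k c *: << k >> :> {freeg K / F} by exact: lin_closedZ.
by apply/eqP/freeg_eqP => k'; rewrite coeffZ !coeffU mul1r.
Qed.

Lemma supp_inT c : supp_in setT c. Proof. by []. Qed.

Lemma sub_supp_in P Q : P `<=` Q -> supp_in P `<=` supp_in Q.
Proof. by move=> PQ c hc k /hc /PQ. Qed.

Lemma lin_closed_eq M M' (f g : {linear M -> M'}) : lin_closed [set c | f c = g c].
Proof. by split => [|a u v /= hu hv] /=; rewrite ?linear0 // !linearP hu hv. Qed.

Lemma lin_closed_preim M M' (f : {linear M -> M'}) (S : set M') :
  lin_closed S -> lin_closed (f @^-1` S).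
Proof.
move=> [s0 sl]; split => [|a u v /= hu hv]; first by rewrite /= linear0.
by rewrite linearP; exact: sl.
Qed.

Lemma eq_lin M (f g : {linear {freeg K / F} -> M}) :
  (forall k, f << k >> = g << k >>) -> f =1 g.
Proof.
move=> h c; apply: (@supp_in_ind setT [set c | f c = g c]); first exact: lin_closed_eq.
  by move=> k _; exact: h.
exact: supp_inT.
Qed.

Lemma supp_in_lext M P (S : set M) (f : K -> M) c : lin_closed S ->
  (forall k, P k -> S (f k)) -> supp_in P c -> S (lext f c).
Proof.
move=> hS hf; apply: (@supp_in_ind P (lext f @^-1` S)); first exact: lin_closed_preim.
by move=> k Pk; rewrite /preimage /= lextU; exact: hf.
Qed.

Lemma eq_lext M P (f g : K -> M) c : (forall k, P k -> f k = g k) -> supp_in P c ->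
  lext f c = lext g c.
Proof.
move=> h; apply: (@supp_in_ind P [set c | lext f c = lext g c]); first exact: lin_closed_eq.
by move=> k /h /=; rewrite !lextU.
Qed.

End FreeModule.

(** * Affine chains, cones and the augmentation *)

Section AffineChains.
Implicit Types (U V W : lmodType R).

Definition achain n V := {freeg ('I_n.+1 -> V) / rat}.

Definition abd n V : {linear achain n.+1 V -> achain n V} :=
  lext (fun v : 'I_n.+2 -> V => \sum_(i < n.+2) (-1) ^+ i *: << v \o lift i >> : achain n V).

Definition pcons n V (b : V) (v : 'I_n.+1 -> V) : 'I_n.+2 -> V :=
  fun i => if unlift ord0 i is Some k then v k else b.

Definition cone n V (b : V) : {linear achain n V -> achain n.+1 V} :=
  lext (fun v => << pcons b v >> : achain n.+1 V).

Definition push n V W (f : V -> W) : {linear achain n V -> achain n W} :=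
  lext (fun v => << f \o v >> : achain n W).

Definition aug V : {linear achain 0 V -> rat^o} := lext (fun _ => 1 : rat^o).

Lemma abdU n V (v : 'I_n.+2 -> V) :
  abd n V << v >> = \sum_(i < n.+2) (-1) ^+ i *: << v \o lift i >>.
Proof. exact: lextU. Qed.

Lemma coneU n V b (v : 'I_n.+1 -> V) : cone n b << v >> = << pcons b v >>.
Proof. exact: lextU. Qed.

Lemma pushU n V W (f : V -> W) (v : 'I_n.+1 -> V) : push n f << v >> = << f \o v >>.
Proof. exact: lextU. Qed.

Lemma pcons_lift0 n V (b : V) (v : 'I_n.+1 -> V) : pcons b v \o lift ord0 = v.
Proof. by apply/funext => i; rewrite /pcons /= liftK. Qed.

Lemma pcons_liftS n V (b : V) (v : 'I_n.+2 -> V) (i : 'I_n.+2) :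
  pcons b v \o lift (lift ord0 i) = pcons b (v \o lift i).
Proof.
apply/funext => k; rewrite /pcons /=.
case: (unliftP ord0 k) => [j ->|->]; last first.
  have -> : lift (lift ord0 i) ord0 = ord0 by apply: val_inj.
  by rewrite !unlift_none.
have -> : lift (lift ord0 i) (lift ord0 j) = lift ord0 (lift i j).
  by apply: val_inj; rewrite /= !/bump /= !add1n ltnS addnS.
by rewrite !liftK.
Qed.

Lemma pcons_lift1 V (b : V) (v : 'I_1 -> V) (i : 'I_1) :
  pcons b v \o lift (lift ord0 i) = fun=> b.
Proof.
apply/funext => k; rewrite /pcons /= !ord1.
have -> : lift (lift ord0 0) 0 = ord0 :> 'I_2 by apply: val_inj.
by rewrite unlift_none.
Qed.

Lemma pconsK n V (v : 'I_n.+2 -> V) : pcons (v ord0) (v \o lift ord0) = v.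
Proof. by apply/funext => k; rewrite /pcons; case: unliftP => [j ->|->]. Qed.

Lemma abd_cone n V (b : V) (x : achain n.+1 V) :
  abd n.+1 V (cone n.+1 b x) = x - cone n b (abd n V x).
Proof.
apply: (@eq_lin _ _ _ (abd n.+1 V \o cone n.+1 b) (idfun \- (cone n b \o abd n V))) => v /=.
rewrite coneU !abdU big_ord_recl /= expr0 scale1r pcons_lift0; congr (_ + _).
rewrite linear_sum -sumrN; apply: eq_bigr => i _ /=.
by rewrite pcons_liftS linearZ /= coneU exprS mulN1r scaleNr.
Qed.

(** In degree 0 the cone formula fails by the augmentation; this is where a nonzero [residue]
    originates. *)
Lemma abd_cone0 V (b : V) (x : achain 0 V) :
  abd 0 V (cone 0 b x) = x - aug V x *: << fun=> b >>.
Proof.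
have lin : linear (fun x => aug V x *: << fun=> b >> : achain 0 V).
  by move=> a u v; rewrite linearP /= scalerDl scalerA.
pose g := GRing.isLinear.Build _ _ _ _ _ lin.
pose f : {linear achain 0 V -> achain 0 V} :=
  HB.pack (fun x => aug V x *: << fun=> b >> : achain 0 V) g.
apply: (@eq_lin _ _ _ (abd 0 V \o cone 0 b) (idfun \- f)) => v /=.
rewrite coneU abdU big_ord_recl big_ord1 /= expr0 scale1r pcons_lift0 pcons_lift1.
by rewrite lextU scale1r scaleN1r.
Qed.

Lemma aug_abd V (x : achain 1 V) : aug V (abd 0 V x) = 0.
Proof.
apply: (@eq_lin _ _ _ (aug V \o abd 0 V) \0) => v /=.
rewrite abdU linear_sum big_ord_recl big_ord1 /= !linearZ /= !lextU.
by rewrite expr0 expr1 scale1r scaleN1r subrr.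
Qed.

(* Every affine simplex is a cone over the face opposite to its first vertex. *)
Lemma abd_abd n V (x : achain n.+2 V) : abd n V (abd n.+1 V x) = 0.
Proof.
elim: n x => [|n IH] x; apply: (@eq_lin _ _ _ (abd _ V \o abd _ V) \0) => v /=;
  rewrite -(pconsK v) -coneU abd_cone linearB /=.
  by rewrite abd_cone0 aug_abd scale0r subr0 subrr.
by rewrite abd_cone IH linear0 subr0 subrr.
Qed.

Lemma push_abd n V W (f : V -> W) x : push n f (abd n V x) = abd n W (push n.+1 f x).
Proof.
apply: (@eq_lin _ _ _ (push n f \o abd n V) (abd n W \o push n.+1 f)) => v /=.
rewrite pushU !abdU linear_sum; apply: eq_bigr => i _.
by rewrite linearZ /= pushU.
Qed.

Lemma push_push n V W U (f : V -> W) (g : W -> U) x :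
  push n g (push n f x) = push n (g \o f) x.
Proof.
by apply: (@eq_lin _ _ _ (push n g \o push n f) (push n (g \o f))) => v /=; rewrite !pushU.
Qed.

End AffineChains.

(** * Singular chains and natural operators given by universal chains *)

Section SingularChains.
Implicit Types (T : topologicalType) (V W : lmodType R).

(** Every function is a generator, continuous or not, so operators extend linearly without carrying
    continuity proofs; continuity and the subset containing the image enter later as a condition on
    the support. *)
Definition schain n T := {freeg (Delta n -> T) / rat}.

Definition sbd n T : {linear schain n.+1 T -> schain n T} :=
  lext (fun s : Delta n.+1 -> T => \sum_(i < n.+2) (-1) ^+ i *: << s \o face_pt n i >> : schain n T).

Lemma sbdU n T (s : Delta n.+1 -> T) :
  sbd n T << s >> = \sum_(i < n.+2) (-1) ^+ i *: << s \o face_pt n i >>.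
Proof. exact: lextU. Qed.

Definition std n (i : 'I_n.+1) : 'rV[R]_n.+1 := delta_mx 0 i.

Lemma comb_std n V (v : 'I_n.+1 -> V) i : comb (std i) v = v i.
Proof.
rewrite /comb (bigD1 i) //= big1 ?addr0; first by rewrite mxE !eqxx scale1r.
by move=> k /negbTE ki; rewrite mxE ki andbF scale0r.
Qed.

Lemma comb_id n (x : 'rV[R]_n.+1) : comb x (@std n) = x.
Proof. by rewrite /comb [RHS]row_sum_delta. Qed.

Lemma comb_face n V (v : 'I_n.+2 -> V) i (x : 'rV[R]_n.+1) :
  comb (face_vec n i x) v = comb x (v \o lift i).
Proof.
rewrite /comb (bigD1_ord i) //= mxE unlift_none scale0r add0r.
by apply: eq_bigr => k _; rewrite mxE liftK.
Qed.

Lemma comb_comb m n V (v : 'I_n.+1 -> V) (w : 'I_m.+1 -> 'rV[R]_n.+1) (x : 'rV[R]_m.+1) :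
  comb (comb x w) v = comb x (fun k => comb (w k) v).
Proof.
rewrite {1 3}/comb; under [RHS]eq_bigr do rewrite scaler_sumr.
rewrite exchange_big /=; apply: eq_bigr => i _.
rewrite /comb summxE scaler_suml; apply: eq_bigr => k _.
by rewrite mxE scalerA.
Qed.

Lemma Delta_std n i : Delta n (std i).
Proof.
split => [j|]; first by rewrite mxE; case: andP.
rewrite (bigD1 i) //= big1 ?addr0; first by rewrite mxE !eqxx.
by move=> k /negbTE ki; rewrite mxE ki andbF.
Qed.

Lemma Delta_comb m n (x : 'rV[R]_m.+1) (v : 'I_m.+1 -> 'rV[R]_n.+1) :
  Delta m x -> (forall i, Delta n (v i)) -> Delta n (comb x v).
Proof.
move=> [x0 x1] hv; split => [i|].
  rewrite summxE; apply: sumr_ge0 => k _; rewrite mxE mulr_ge0 //.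
  by case: (hv k) => + _; exact.
under eq_bigr do rewrite summxE.
rewrite exchange_big -[RHS]x1; apply: eq_bigr => k _ /=.
under eq_bigr do rewrite mxE.
by rewrite -mulr_sumr; case: (hv k) => _ ->; rewrite mulr1.
Qed.

Definition bary n : 'rV[R]_n.+1 := const_mx (n.+1%:R^-1).

Lemma Delta_bary n : Delta n (bary n).
Proof.
split => [j|]; first by rewrite mxE invr_ge0.
under eq_bigr do rewrite mxE.
by rewrite sumr_const card_ord -(mulr_natr _^-1) mulVf // pnatr_eq0.
Qed.

(* Any retraction of the space of vectors onto the simplex: it only serves to
   make simplices total functions ([hat]). *)
Definition Dpt n (y : 'rV[R]_n.+1) : Delta n :=
  insubd (exist (fun y => y \in Delta n) (std ord0) (mem_set (Delta_std ord0))) y.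

Lemma DptK n y : Delta n y -> set_val (Dpt y) = y.
Proof. by move=> hy; rewrite set_valE /Dpt val_insubd mem_set. Qed.

Lemma set_valK n (x : Delta n) : Dpt (set_val x) = x.
Proof. by apply: val_inj; rewrite -set_valE DptK //; exact/set_mem/valP. Qed.

Lemma Delta_set_val n (x : Delta n) : Delta n (set_val x).
Proof. exact/set_mem/valP. Qed.

Definition real m V T (f : V -> T) (v : 'I_m.+1 -> V) : Delta m -> T :=
  fun x => f (comb (set_val x) v).

Definition realc m V T (f : V -> T) : {linear achain m V -> schain m T} :=
  lext (fun v => << real f v >> : schain m T).

Lemma realcU m V T (f : V -> T) (v : 'I_m.+1 -> V) : realc m f << v >> = << real f v >>.
Proof. exact: lextU. Qed.

Lemma sbd_realc m V T (f : V -> T) c :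
  sbd m T (realc m.+1 f c) = realc m f (abd m V c).
Proof.
apply: (@eq_lin _ _ _ (sbd m T \o realc m.+1 f) (realc m f \o abd m V)) => v /=.
rewrite realcU sbdU abdU linear_sum; apply: eq_bigr => i _.
rewrite linearZ /= realcU; congr (_ *: << _ >>); apply/funext => x.
by rewrite /real /= set_valE /= comb_face.
Qed.

Lemma realc_push m V W T (f : W -> T) (g : V -> W) c :
  (forall (x : 'rV[R]_m.+1) v, g (comb x v) = comb x (g \o v) :> W) ->
  realc m f (push m g c) = realc m (f \o g) c.
Proof.
move=> hg; apply: (@eq_lin _ _ _ (realc m f \o push m g) (realc m (f \o g))) => v /=.
rewrite pushU !realcU; congr << _ >>; apply/funext => x.
by rewrite /real /= hg.
Qed.

Definition hat n T (s : Delta n -> T) : 'rV[R]_n.+1 -> T := fun y => s (Dpt y).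

Lemma realc_hat n T (s : Delta n -> T) : realc n (hat s) << @std n >> = << s >>.
Proof.
rewrite realcU; congr << _ >>; apply/funext => x.
by rewrite /real comb_id /hat set_valK.
Qed.

(** Each singular simplex is the realization of the standard affine simplex, which reduces the claim
    to [abd_abd]. *)
Lemma sbd_sbd n T (c : schain n.+2 T) : sbd n T (sbd n.+1 T c) = 0.
Proof.
apply: (@eq_lin _ _ _ (sbd _ T \o sbd _ T) \0) => s /=.
by rewrite -realc_hat !sbd_realc abd_abd linear0.
Qed.

(* A natural operator on singular chains is determined by its value on the
   identity of each [Delta n]; here values live in affine chains of
   [Delta n x R], the second factor being the time of a homotopy. *)
Definition model n : lmodType R := ('rV[R]_n.+1 * R^o)%type.

Definition in_model m n : set ('I_m.+1 -> model n) := [set v | forall i, Delta n (v i).1].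

(** The universal chain [u] is carried to [T x R] by [s] times the identity of time, then to [T'] by
    [H]. With [H z t = z] this is an operator on the chains of [T]. *)
Definition natop m n T T' (u : achain m (model n)) (H : T -> R -> T') :
    {linear schain n T -> schain m T'} :=
  lext (fun s => realc m (fun p : model n => H (hat s p.1) p.2) u).

Lemma natopU m n T T' (u : achain m (model n)) (H : T -> R -> T') s :
  natop u H << s >> = realc m (fun p : model n => H (hat s p.1) p.2) u.
Proof. exact: lextU. Qed.

Lemma sbd_natop m n T T' (u : achain m.+1 (model n)) (H : T -> R -> T') c :
  sbd m T' (natop u H c) = natop (abd m _ u) H c.
Proof.
apply: (@eq_lin _ _ _ (sbd m T' \o natop u H) (natop (abd m _ u) H)) => s /=.
by rewrite !natopU sbd_realc.
Qed.

Lemma natopB m n T T' (u u' : achain m (model n)) (H : T -> R -> T') c :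
  natop (u - u') H c = natop u H c - natop u' H c.
Proof.
by apply: (@eq_lin _ _ _ (natop (u - u') H) (natop u H \- natop u' H)) => s /=;
    rewrite !natopU linearB.
Qed.

Definition afmap n n' (v : 'I_n.+1 -> 'rV[R]_n'.+1) (p : model n) : model n' :=
  (comb p.1 v, p.2).

Definition transport m n n' (u : achain m (model n)) :
    {linear achain n 'rV[R]_n'.+1 -> achain m (model n')} :=
  lext (fun v => push m (afmap v) u).

(** The universal chain of the operator preceded by the boundary, as [natop_sbd] shows. *)
Definition natd m n (u : achain m (model n)) : achain m (model n.+1) :=
  transport n.+1 u (abd n _ << @std n.+1 >>).

Lemma comb_afmap m n n' (v : 'I_n.+1 -> 'rV[R]_n'.+1) (x : 'rV[R]_m.+1) (w : 'I_m.+1 -> model n) :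
  afmap v (comb x w) = comb x (afmap v \o w) :> model n'.
Proof.
have h1 k (z : 'I_m.+1 -> model k) : (comb x z).1 = comb x (fun i => (z i).1).
  by rewrite /comb raddf_sum.
have h2 k (z : 'I_m.+1 -> model k) : (comb x z).2 = comb x (fun i => (z i).2 : R^o).
  by rewrite /comb raddf_sum.
by apply: injective_projections; rewrite /= ?h1 ?h2 //= comb_comb.
Qed.

Lemma natdE m n (u : achain m (model n)) :
  natd u = \sum_(i < n.+2) (-1) ^+ i *: push m (afmap (@std n.+1 \o lift i)) u.
Proof.
rewrite /natd abdU linear_sum; apply: eq_bigr => i _.
by rewrite linearZ /= /transport lextU.
Qed.

Lemma natd_linear m n a (u v : achain m (model n)) :
  natd (a *: u + v) = a *: natd u + natd v.
Proof.
rewrite !natdE scaler_sumr -big_split; apply: eq_bigr => i _ /=.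
by rewrite linearP /= scalerDr !scalerA mulrC.
Qed.

Lemma natdB m n (u v : achain m (model n)) : natd (u - v) = natd u - natd v.
Proof. by rewrite addrC -scaleN1r natd_linear scaleN1r addrC. Qed.

Lemma natd0 m n : natd (0 : achain m (model n)) = 0.
Proof. by rewrite -(subrr 0) natdB subrr. Qed.

Lemma abd_natd m n (u : achain m.+1 (model n)) : abd m _ (natd u) = natd (abd m _ u).
Proof.
rewrite !natdE linear_sum; apply: eq_bigr => i _.
by rewrite linearZ /= push_abd.
Qed.

Lemma push_transport m n n' k (u : achain m (model n)) (v : 'I_n'.+1 -> 'rV[R]_k.+1)
    (c : achain n 'rV[R]_n'.+1) :
  push m (afmap v) (transport n' u c) = transport k u (push n (fun x => comb x v) c).
Proof.
apply: (@eq_lin _ _ _ (push m (afmap v) \o transport n' u)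
  (transport k u \o push n (fun x => comb x v))) => w /=.
rewrite pushU /transport !lextU push_push; congr (push m _ u).
by apply/funext => p; rewrite /afmap /= comb_comb.
Qed.

Lemma natd_natd m n (u : achain m (model n)) : natd (natd u) = 0.
Proof.
rewrite natdE.
under eq_bigr => i _.
  rewrite [natd u]/natd push_transport push_abd pushU.
  rewrite (_ : _ \o _ = @std n.+2 \o lift i); last first.
    by apply/funext => k /=; rewrite comb_std.
  rewrite -linearZ /= -linearZ /=; over.
by rewrite -linear_sum -linear_sum /= -abdU abd_abd linear0.
Qed.

Lemma supp_in_push m n n' (v : 'I_n.+1 -> 'rV[R]_n'.+1) (u : achain m (model n)) :
  (forall i, Delta n' (v i)) -> supp_in (@in_model m n) u ->
  supp_in (@in_model m n') (push m (afmap v) u).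
Proof.
move=> hv hu; apply: (supp_in_lext (S := supp_in (@in_model m n')) _ _ hu).
  exact: lin_closed_supp_in.
by move=> w hw; apply: supp_inU => i /=; exact: Delta_comb.
Qed.

Lemma supp_in_natd m n (u : achain m (model n)) :
  supp_in (@in_model m n) u -> supp_in (@in_model m n.+1) (natd u).
Proof.
move=> hu; have hS := @lin_closed_supp_in rat _ (@in_model m n.+1).
rewrite natdE; apply: (lin_closed_sum _ hS) => i _; apply: (lin_closedZ _ hS).
by apply: supp_in_push => // k; exact: Delta_std.
Qed.

(** The support condition matters because [hat] uses the arbitrary retraction [Dpt]: extending a
    face of [s], and restricting the extension of [s] to that face, agree only over the simplex
    itself. *)
Lemma natop_sbd m n T T' (u : achain m (model n)) (H : T -> R -> T') c :
  supp_in (@in_model m n) u -> natop u H (sbd n T c) = natop (natd u) H c.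
Proof.
move=> hu; apply: (@eq_lin _ _ _ (natop u H \o sbd n T) (natop (natd u) H)) => s /=.
rewrite sbdU natopU natdE !linear_sum; apply: eq_bigr => i _.
rewrite !linearZ /= natopU realc_push; last by move=> x v; exact: comb_afmap.
congr (_ *: _); apply: eq_lext hu => v hv; congr << _ >>; apply/funext => x.
rewrite /real /= /hat /=; congr (H (s _) _).
have h1 : (comb (set_val x) v).1 = comb (set_val x) (fun i => (v i).1).
  by rewrite /comb raddf_sum.
have hD : Delta n (comb (set_val x) v).1.
  by rewrite h1; apply: Delta_comb => //; exact: Delta_set_val.
rewrite -[LHS]set_valK; congr Dpt.
have -> : set_val (face_pt n i (Dpt (comb (set_val x) v).1)) =
    face_vec n i (set_val (Dpt (comb (set_val x) v).1)) by rewrite set_valE.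
by rewrite (DptK hD) -comb_face comb_id.
Qed.

(* A chain homotopy from [w] to 0 by cones; it fails to be one by [residue]. *)
Fixpoint fill (w : forall n, achain n (model n)) n : achain n.+1 (model n) :=
  cone n (bary n, 0 : R^o)
    (match n return achain n (model n) with
     | 0 => w 0
     | n'.+1 => w n'.+1 - natd (fill w n')
     end).

Definition natd_prev (t : forall n, achain n.+1 (model n)) n : achain n (model n) :=
  match n return achain n (model n) with 0 => 0 | n'.+1 => natd (t n') end.

Definition residue (w : forall n, achain n (model n)) n := w n - abd n _ (fill w n) - natd_prev (fill w) n.

Lemma residue0 (w : forall n, achain n (model n)) : residue w 0 = aug _ (w 0) *: << fun=> (bary 0, 0 : R^o) >>.
Proof. by rewrite /residue /= abd_cone0 subr0 subKr. Qed.

(** The cone formula applied to [fill] cancels everything but the cone over [natd (residue w n)], by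
    naturality of [w] and [natd_natd]. For the identity this is the recursion of barycentric
    subdivision: join the barycenter to the subdivided boundary. *)
Lemma residueS (w : forall n, achain n (model n)) n : (forall n, abd n _ (w n.+1) = natd (w n)) ->
  residue w n.+1 = cone n (bary n.+1, 0 : R^o) (natd (residue w n)).
Proof.
move=> hw; have fE : fill w n.+1 = cone n.+1 (bary n.+1, 0 : R^o) (w n.+1 - natd (fill w n)) by [].
have cancel (G : zmodType) (a b x : G) : a - (a - b - x) - b = x.
  by rewrite opprB opprB addrCA [a + _]addrC subrK addrK.
rewrite {1}/residue fE abd_cone cancel.
rewrite linearB hw abd_natd -natdB.
congr (cone n _ _); rewrite !natdB.
suff -> : natd (natd_prev (fill w) n) = 0 by rewrite subr0.
by case: n {fE} => [|n] /=; rewrite ?natd0 ?natd_natd.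
Qed.

Lemma supp_in_fill (w : forall n, achain n (model n)) n : (forall n,
    supp_in (@in_model n n) (w n)) ->
  supp_in (@in_model n.+1 n) (fill w n).
Proof.
move=> hw.
have hcone n' (x : achain n' (model n')) : supp_in (@in_model _ _) x ->
    supp_in (@in_model _ _) (cone n' (bary n', 0 : R^o) x).
  move=> hx; apply: (supp_in_lext (S := supp_in (@in_model n'.+1 n')) _ _ hx).
    exact: lin_closed_supp_in.
  move=> v hv; apply: supp_inU => i; rewrite /pcons.
  by case: unlift => [k|] //; exact: Delta_bary.
elim: n => [|n IH]; apply: hcone => //.
by apply: (lin_closedB (@lin_closed_supp_in rat _ (@in_model n.+1 n.+1))) => //;
    exact: supp_in_natd.
Qed.

Lemma natop_fill (w : forall n, achain n (model n)) n T T' (H : T -> R ->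
    T') c : (forall n, supp_in (@in_model n n) (w n)) ->
  sbd n.+1 T' (natop (fill w n.+1) H c) + natop (fill w n) H (sbd n T c) =
  natop (w n.+1) H c - natop (residue w n.+1) H c.
Proof.
move=> hw; rewrite sbd_natop natop_sbd; last exact: supp_in_fill.
have cancel (G : zmodType) (x a b : G) : a + b = x - (x - a - b).
  by rewrite -addrA -opprD subKr.
by rewrite /residue !natopB -cancel.
Qed.

Lemma natop_fill0 (w : forall n, achain n (model n)) T T' (H : T -> R -> T') c :
  sbd 0 T' (natop (fill w 0) H c) = natop (w 0) H c - natop (residue w 0) H c.
Proof. by rewrite sbd_natop /residue subr0 natopB subKr. Qed.

Definition slice (s : R) n : achain n (model n) := << fun i => (std i, s) >>.

Lemma supp_in_slice s n : supp_in (@in_model n n) (slice s n).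
Proof. by apply: supp_inU => i; exact: Delta_std. Qed.

Lemma abd_slice s n : abd n _ (slice s n.+1) = natd (slice s n).
Proof.
rewrite natdE abdU; apply: eq_bigr => i _; rewrite pushU; congr (_ *: << _ >>).
by apply/funext => k; rewrite /= /afmap /= comb_std.
Qed.

Lemma natop_slice s n T T' (H : T -> R -> T') (r : Delta n -> T) :
  natop (slice s n) H << r >> = << fun x => H (r x) s >>.
Proof.
rewrite natopU realcU; congr << _ >>; apply/funext => x; rewrite /real.
have -> : comb (set_val x) (fun i => (std i, s) : model n) = (set_val x, s).
  apply: injective_projections; rewrite /comb raddf_sum /=; first exact: comb_id.
  by rewrite -scaler_suml; case: (Delta_set_val x) => _ ->; rewrite scale1r.
by rewrite /= /hat set_valK.
Qed.

Definition prism n := fill (fun n => slice 1 n - slice 0 n) n.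

(** The augmentations of the two ends cancel in degree 0, and [residueS] propagates the zero. *)
Lemma residue_prism n : residue (fun n => slice 1 n - slice 0 n) n = 0.
Proof.
elim: n => [|n IH].
  by rewrite residue0 linearB /= /aug !lextU subrr scale0r.
rewrite residueS; first by rewrite IH natd0 linear0.
by move=> k; rewrite linearB /= !abd_slice natdB.
Qed.

End SingularChains.

(** * Topology of the standard simplex *)

Section SimplexTopology.

Lemma continuousRD (T : topologicalType) (f g : T -> R) x :
  {for x, continuous f} -> {for x, continuous g} ->
  {for x, continuous (fun t => f t + g t)}.
Proof. exact: (@cvgD R R^o). Qed.

Lemma continuousRN (T : topologicalType) (f : T -> R) x :
  {for x, continuous f} -> {for x, continuous (fun t => - f t)}.
Proof. exact: (@cvgN R R^o). Qed.

Lemma continuousRM (T : topologicalType) (f g : T -> R) x :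
  {for x, continuous f} -> {for x, continuous g} ->
  {for x, continuous (fun t => f t * g t)}.
Proof. exact: (@cvgM R). Qed.

Lemma continuousR_near (T : topologicalType) (f : T -> R) x (e : R) :
  {for x, continuous f} -> 0 < e -> \forall t \near x, `|f x - f t| < e.
Proof. by move=> /(@cvgr_dist_lt R R^o); apply. Qed.

Lemma continuous_bigsum (T : topologicalType) (I : Type) (r : seq I) (f : I -> T -> R) :
  (forall i, continuous (f i)) -> continuous (fun x => \sum_(i <- r) f i x).
Proof.
move=> hf; elim: r => [|i r IH].
  have -> : (fun x => \sum_(i <- [::]) f i x) = cst 0 by apply/funext => x; rewrite big_nil.
  exact: cst_continuous.
have -> : (fun x => \sum_(j <- i :: r) f j x) = (fun x => f i x + \sum_(j <- r) f j x).
  by apply/funext => x; rewrite big_cons.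
by move=> x; apply: continuousRD; [exact: hf | exact: IH].
Qed.

Lemma continuous_rV (T : topologicalType) n (f : T -> 'rV[R]_n) x :
  (forall j, {for x, continuous (fun t => f t 0 j)}) -> {for x, continuous f}.
Proof.
move=> hf A [P hP PA].
have : \forall t \near x, forall j, P 0 j (f t 0 j).
  by apply: filter_forall => j; apply: hf; exact: hP.
by apply: filterS => t ht; apply: PA => i j; rewrite ord1.
Qed.

Lemma continuous_Delta (T : topologicalType) n (f : T -> Delta n) x :
  {for x, continuous (fun t => set_val (f t))} -> {for x, continuous f}.
Proof.
move=> hf A; rewrite nbhsE => -[B [[C oC <-] Bx] BA].
by apply: (filterS BA); apply: hf; exact: open_nbhs_nbhs.
Qed.

Lemma continuous_coord n (i : 'I_n.+1) : continuous (fun x : Delta n => set_val x 0 i).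
Proof.
move=> x; apply: (@continuous_comp _ _ _ _ (fun v : 'rV[R]_n.+1 => v 0 i)).
  exact: (@initial_continuous (Delta n) 'rV[R]_n.+1 set_val).
exact: coord_continuous.
Qed.

Lemma continuous_comb n (v : 'I_n.+1 -> R^o) :
  continuous (fun x : Delta n => comb (set_val x) v : R).
Proof.
apply: continuous_bigsum => i x; apply: continuousRM; last exact: cst_continuous.
exact: continuous_coord.
Qed.

Lemma comb_fst m n (x : 'rV[R]_m.+1) (v : 'I_m.+1 -> model n) :
  (comb x v).1 = comb x (fun i => (v i).1).
Proof. by rewrite /comb raddf_sum. Qed.

Lemma comb_snd m n (x : 'rV[R]_m.+1) (v : 'I_m.+1 -> model n) :
  (comb x v).2 = comb x (fun i => (v i).2 : R^o).
Proof. by rewrite /comb raddf_sum. Qed.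

Lemma comb_coord m n (x : 'rV[R]_m.+1) (v : 'I_m.+1 -> 'rV[R]_n.+1) l :
  comb x v 0 l = comb x (fun i => v i 0 l : R^o).
Proof. by rewrite /comb summxE; apply: eq_bigr => i _; rewrite mxE. Qed.

Lemma continuous_affine m n (v : 'I_m.+1 -> 'rV[R]_n.+1) :
  (forall i, Delta n (v i)) -> continuous (fun x : Delta m => Dpt (comb (set_val x) v)).
Proof.
move=> hv x; apply: continuous_Delta; apply: continuous_rV => j.
have -> : (fun t : Delta m => set_val (Dpt (comb (set_val t) v)) 0 j) =
    (fun t => comb (set_val t) (fun i => v i 0 j : R^o)).
  apply/funext => t; rewrite DptK ?comb_coord //.
  by apply: Delta_comb => //; exact: Delta_set_val.
exact: continuous_comb.
Qed.

Lemma continuous_face_pt n i : continuous (face_pt n i).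
Proof.
have -> : face_pt n i = fun x => Dpt (comb (set_val x) (@std n.+1 \o lift i)).
  apply/funext => x; rewrite -[LHS]set_valK; congr Dpt.
  have -> : set_val (face_pt n i x) = face_vec n i (set_val x) by rewrite set_valE.
  by rewrite -comb_face comb_id.
by apply: continuous_affine => k; exact: Delta_std.
Qed.

Lemma closed_ge0 n (i : 'I_n.+1) : closed [set v : 'rV[R]_n.+1 | 0 <= v 0 i].
Proof.
apply: (@preimage_closed _ _ (fun v : 'rV[R]_n.+1 => v 0 i) [set x : R | 0 <= x]).
  by move=> v _; exact: coord_continuous.
exact: closed_ge.
Qed.

Lemma compact_Delta n : compact (Delta n).
Proof.
apply: (@subclosed_compact _ _ [set v : 'rV[R]_n.+1 | forall i, `[0, 1]%classic (v ord0 i)]).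
- have -> : Delta n = (\bigcap_(i in [set: 'I_n.+1]) [set v : 'rV[R]_n.+1 | 0 <= v 0 i]) `&`
      [set v : 'rV[R]_n.+1 | \sum_i v 0 i = 1].
    rewrite eqEsubset; split=> v.
      by move=> [v0 v1]; split => // i _; exact: v0.
    by move=> [v0 v1]; split => // i; exact: v0.
  apply: closedI.
    by apply: closed_bigI => i _; exact: closed_ge0.
  apply: (@preimage_closed _ _ (fun v : 'rV[R]_n.+1 => \sum_i v 0 i : R) [set 1]).
    move=> v _; apply: (@continuous_bigsum 'rV[R]_n.+1) => i w; exact: coord_continuous.
  exact: closed_eq.
- exact: rV_compact (fun i => @segment_compact _ 0 1).
- move=> v [v0 v1] i; rewrite /= in_itv /= v0 /= -v1 (bigD1 i) //= lerDl.
  by apply: sumr_ge0 => j _; exact: v0.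
Qed.

Lemma near_coords n (x : 'rV[R]_n.+1) (e : R) : 0 < e ->
  nbhs x [set y : 'rV[R]_n.+1 | forall l, `|x 0 l - y 0 l| < e].
Proof.
move=> e0.
apply: (@filter_forall _ _ (fun l => [set y : 'rV[R]_n.+1 | `|x 0 l - y 0 l| < e]) (nbhs x)) => l.
exact: (continuousR_near (@coord_continuous R 1 n.+1 0 l x)).
Qed.

(** Near each point one of the two alternatives of [good] holds for all small [e] at once;
    compactness of the simplex makes one [e] serve everywhere. Distances are measured coordinate by
    coordinate. *)
Lemma lebesgue_number (T : topologicalType) n (s : Delta n -> T) (A B : set T) :
  continuous s -> open A -> open B -> (forall x, (A `|` B) (s x)) ->
  exists2 e : R, 0 < e & forall x, Delta n x ->
    (forall y, Delta n y -> (forall l, `|x 0 l - y 0 l| < e) -> A (hat s y)) \/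
    (forall y, Delta n y -> (forall l, `|x 0 l - y 0 l| < e) -> B (hat s y)).
Proof.
move=> cs oA oB sAB.
pose good (C : set T) (e : R) (x : 'rV[R]_n.+1) := forall y, Delta n y ->
  (forall l, `|x 0 l - y 0 l| < e) -> C (hat s y).
have loc C x : open C -> Delta n x -> C (hat s x) ->
    \forall x' \near x & e \near (0 : R)^'+, good C e x'.
  move=> oC Dx Cx.
  have : nbhs (Dpt x) (s @^-1` C) by apply: cs; exact: open_nbhs_nbhs.
  rewrite nbhsE => -[_ [[W oW <-] /= Wx] WC].
  rewrite (DptK Dx) in Wx.
  have [r r0 hr] : exists2 r : R, 0 < r & forall y : 'rV[R]_n.+1, (forall l,
      `|x 0 l - y 0 l| < r) -> W y.
    have : nbhs x W by exact: open_nbhs_nbhs.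
    move=> [P hP PW].
    have : \forall r \near (0 : R)^'+, forall l, forall z, `|x 0 l - z| < r -> P 0 l z.
      apply: filter_forall => l; have /nbhs_ballP [r /= r0 rP] := hP 0 l.
      near=> r' => z hz; apply: rP; rewrite /ball /=; apply: lt_le_trans hz _.
      by near: r'; exact: nbhs_right_le.
    move=> hr; have : \forall r \near (0 : R)^'+, 0 < r by exact: nbhs_right_gt.
    move=> h0; near (0 : R)^'+ => r; exists r; first by near: r.
    move=> y hy; apply: PW => i l; rewrite ord1.
    have /(_ l (y 0 l) (hy l)) // : forall l z, `|x 0 l - z| < r -> P 0 l z by near: r.
  (* Half of the radius [r] is spent on moving the center from [x] to [x'], the other half on
     [e]. *)
  near=> x' e.
  have er : e <= r / 2 by near: e; apply: nbhs_right_le; rewrite divr_gt0.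
  have xr : forall l, `|x 0 l - x' 0 l| < r / 2.
    by near: x'; apply: near_coords; rewrite divr_gt0.
  move=> y Dy hy; apply: WC => /=; rewrite (DptK Dy); apply: hr => l.
  rewrite (splitr r); apply: (le_lt_trans (ler_distD (x' 0 l) _ _)); apply: ltrD => //.
  exact: lt_le_trans (hy l) er.
have /compact_near_coveringP/(_ _ (0 : R)^'+ (fun e x =>
    good A e x \/ good B e x)) := @compact_Delta n.
move=> cov.
have h : forall x, Delta n x -> \forall x' \near x & e \near (0 : R)^'+, good A e x' \/ good B e x'.
  move=> x Dx; case: (sAB (Dpt x)) => hx.
    by have := loc A x oA Dx hx; apply: filterS => -[x' e] h; left.
  by have := loc B x oB Dx hx; apply: filterS => -[x' e] h; right.
have hnear := cov ltac:(typeclasses eauto) h.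
have h0 : \forall e \near (0 : R)^'+, 0 < e by exact: nbhs_right_gt.
near (0 : R)^'+ => e; exists e; first by near: e.
have : Delta n `<=` [set x | good A e x \/ good B e x] by near: e.
exact.
Unshelve. all: by end_near. Qed.
End SimplexTopology.

(** * Homotopy invariance *)

Section Supports.
Implicit Types T : topologicalType.

Lemma continuous_pair T T' T'' (f : T -> T') (g : T -> T'') x :
  {for x, continuous f} -> {for x, continuous g} ->
  {for x, continuous (fun t => (f t, g t))}.
Proof. by move=> hf hg; exact: (cvg_pair hf hg). Qed.

Definition schains T : nat -> lmodType rat := fun n => schain n T.

Definition sset n T (U : set T) : set (Delta n -> T) :=
  [set s | continuous s /\ forall x, U (s x)].

Definition sch T (U : set T) n : set (schains T n) := supp_in (@sset n T U).
Arguments sch : clear implicits.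

Lemma lin_closed_sch T (U : set T) n : lin_closed (sch T U n).
Proof. exact: lin_closed_supp_in. Qed.

Definition dsing T n : {linear schains T n.+1 -> schains T n} := sbd n T.

Lemma dsing_dsing T n c : dsing T n (dsing T n.+1 c) = 0.
Proof. exact: sbd_sbd. Qed.

Definition chi T (U : set T) (e : int) := euler (dsing T) (sch T U) e.

Lemma sset_face n T (U : set T) (s : Delta n.+1 -> T) i :
  sset U s -> sset U (s \o face_pt n i).
Proof.
move=> [cs Us]; split => [x|x]; last exact: Us.
by apply: continuous_comp; [exact: continuous_face_pt | exact: cs].
Qed.

Lemma subcomplex_sch T (U : set T) : subcomplex (dsing T) (sch T U).
Proof.
split => n; first exact: lin_closed_sch.
move=> c hc; apply: (supp_in_lext (lin_closed_sch U n) _ hc) => s hs.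
apply: (lin_closed_sum _ (lin_closed_sch U n)) => i _.
apply: (lin_closedZ _ (lin_closed_sch U n)); apply: supp_inU; exact: sset_face.
Qed.

Lemma sub_sch T (U U' : set T) n : U `<=` U' -> sch T U n `<=` sch T U' n.
Proof. by move=> UU'; apply: sub_supp_in => s [cs Us]; split => // x; exact: UU'. Qed.

(** Time runs over the whole line, so a homotopy on [0, 1] is to be extended by clamping; continuity
    is required only at points of [U], but in the topology of the ambient space. *)
Definition cont_homotopy T T' (U : set T) (U' : set T') (H : T -> R -> T') :=
  (forall z t, U z -> U' (H z t)) /\
  (forall z t, U z -> {for (z, t), continuous (fun p : T * R => H p.1 p.2)}).

Lemma sset_real m n T T' U U' (H : T -> R -> T') (s : Delta n -> T) (v : 'I_m.+1 -> model n) :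
  cont_homotopy U U' H -> sset U s -> in_model v ->
  sset U' (real (fun p : model n => H (hat s p.1) p.2) v).
Proof.
move=> [HU Hc] [cs Us] hv; split => [x|x]; last by apply: HU; exact: Us.
have -> : real (fun p : model n => H (hat s p.1) p.2) v = (fun p : T * R => H p.1 p.2) \o
    (fun x => (s (Dpt (comb (set_val x) (fun i => (v i).1))),
               comb (set_val x) (fun i => (v i).2 : R^o) : R)).
  by apply/funext => y; rewrite /real comb_fst comb_snd.
apply: continuous_comp => /=; last first.
  by apply: Hc; exact: Us.
apply: continuous_pair; last exact: continuous_comb.
apply: (@continuous_comp _ _ _ (fun x : Delta m => Dpt (comb (set_val x) (fun i => (v i).1))) s).
  exact: continuous_affine.
exact: cs.
Qed.

Lemma sch_natop m n T T' U U' (H : T -> R -> T') (u : achain m (model n)) c :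
  cont_homotopy U U' H -> supp_in (@in_model m n) u -> sch T U n c ->
  sch T' U' m (natop u H c).
Proof.
move=> hH hu hc; apply: (supp_in_lext (lin_closed_sch U' m) _ hc) => s hs.
apply: (supp_in_lext (lin_closed_sch U' m) _ hu) => v hv.
by apply: supp_inU; exact: sset_real hs hv.
Qed.

Lemma cont_homotopy_fst T (U : set T) : cont_homotopy U U (fun z _ => z).
Proof. by split => // z t Uz; exact: cvg_fst. Qed.

End Supports.
Arguments sch : clear implicits.

(** * Induced chain maps and homotopy equivalences *)

Section Homotopy.
Implicit Types T P : topologicalType.

Definition smap n T T' (f : T -> T') : {linear schain n T -> schain n T'} :=
  lext (fun s => << f \o s >> : schain n T').

Lemma smapU n T T' (f : T -> T') (s : Delta n -> T) : smap n f << s >> = << f \o s >>.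
Proof. exact: lextU. Qed.

Lemma smap_dsing n T T' (f : T -> T') c : smap n f (dsing T n c) = dsing T' n (smap n.+1 f c).
Proof.
apply: (@eq_lin _ _ _ (smap n f \o dsing T n) (dsing T' n \o smap n.+1 f)) => s /=.
rewrite smapU /dsing !sbdU linear_sum; apply: eq_bigr => i _.
by rewrite linearZ /= smapU.
Qed.

Lemma smap_smap n T T' T'' (f : T -> T') (g : T' -> T'') c :
  smap n g (smap n f c) = smap n (g \o f) c.
Proof.
by apply: (@eq_lin _ _ _ (smap n g \o smap n f) (smap n (g \o f))) => s /=; rewrite !smapU.
Qed.

Lemma smap_id n T (U : set T) (f : T -> T) c : (forall x, U x -> f x = x) ->
  sch T U n c -> smap n f c = c.
Proof.
move=> hf hc; transitivity (lext (fun s : Delta n -> T => << s >> : schain n T) c); last first.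
  by apply: (@eq_lin _ _ _ (lext _) idfun) => s; rewrite lextU.
apply: eq_lext hc => s [_ Us]; congr << _ >>; apply/funext => x /=; exact: hf.
Qed.

Lemma natop_sliceE n T T' (H : T -> R -> T') t c :
  natop (slice t n) H c = smap n (H^~ t) c.
Proof.
apply: (@eq_lin _ _ _ (natop (slice t n) H) (smap n (H^~ t))) => s /=.
by rewrite smapU natop_slice.
Qed.

Definition cont_on T T' (U : set T) (U' : set T') (f : T -> T') :=
  (forall z, U z -> U' (f z)) /\ (forall z, U z -> {for z, continuous f}).

Lemma sch_smap n T T' U U' (f : T -> T') c : cont_on U U' f -> sch T U n c ->
  sch T' U' n (smap n f c).
Proof.
move=> [fU fc] hc; apply: (supp_in_lext (lin_closed_sch U' n) _ hc) => s [cs Us].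
apply: supp_inU; split => [x|x]; last exact: fU.
by apply: continuous_comp; [exact: cs | exact: fc].
Qed.

Lemma cyc_smap n T T' U U' (f : T -> T') c : cont_on U U' f -> cyc (dsing T) (sch T U) n c ->
  cyc (dsing T') (sch T' U') n (smap n f c).
Proof.
move=> hf [hc cc]; split; first exact: sch_smap hc.
case: n c hc cc => [|n] c hc // cc; change (dsing T' n (smap n.+1 f c) = 0).
by rewrite -smap_dsing (_ : dsing T n c = 0) ?linear0.
Qed.

Lemma bnd_smap n T T' U U' (f : T -> T') c : cont_on U U' f -> bnd (dsing T) (sch T U) n c ->
  bnd (dsing T') (sch T' U') n (smap n f c).
Proof.
by move=> hf [b hb ->]; exists (smap n.+1 f b); [exact: sch_smap hb | exact: smap_dsing].
Qed.

Lemma homotopy_bnd n T T' U U' (H : T -> R -> T') c : cont_homotopy U U' H ->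
  cyc (dsing T) (sch T U) n c ->
  bnd (dsing T') (sch T' U') n (smap n (H^~ 1) c - smap n (H^~ 0) c).
Proof.
move=> hH [hc cc].
have hs k : supp_in (@in_model k k) (slice 1 k - slice 0 k).
  by apply: (lin_closedB (@lin_closed_supp_in rat _ (@in_model k k))); exact: supp_in_slice.
have hp k : supp_in (@in_model k.+1 k) (prism k) by exact: supp_in_fill.
exists (natop (prism n) H c); first exact: sch_natop hc.
have e0 k d : natop (residue (fun n => slice 1 n - slice 0 n) k) H d = 0 :> schain k T'.
  rewrite residue_prism; apply: (@eq_lin _ _ _ (natop 0 H) \0) => s /=.
  by rewrite natopU linear0.
rewrite -!natop_sliceE -natopB; case: n c hc cc => [|n] c hc cc.
  by rewrite /dsing /prism natop_fill0 e0 subr0.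
have := natop_fill H c hs; rewrite e0 subr0 => <-.
by rewrite [sbd n T c]cc linear0 addr0.
Qed.

(** Cycles [c] and [c'] are related when [c'] minus the image of [c] under [f] is a boundary. Since
    [g] inverts [f] exactly on [W], a single homotopy, from the identity to [f \o g], suffices. *)
Lemma hdim_homotopy_equiv n d T P (U : set T) (W : set P) (f : P -> T) (g : T -> P)
    (H : T -> R -> T) :
  cont_on W U f -> cont_on U W g -> (forall x, W x -> g (f x) = x) ->
  cont_homotopy U U H -> (forall z, U z -> H z 0 = z) -> (forall z, U z -> H z 1 = f (g z)) ->
  hdimc (dsing P) (sch P W) n d -> hdimc (dsing T) (sch T U) n d.
Proof.
move=> hf hg gf hH H0 H1.
have hP := subcomplex_sch W; have hT := subcomplex_sch U.
have [b0 bl] := lin_closed_bnd n hT.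
apply: (@qdim_rel _ _ _ _ _ _ _ (fun c c' => bnd (dsing T) (sch T U) n (c' - smap n f c))).
- exact: lin_closed_cyc.
- exact: lin_closed_cyc.
- move=> a u v u' v' hu hv; rewrite linearP opprD addrACA -scalerBr; exact: bl.
- by rewrite linear0 subrr.
- by move=> c hc; exists (smap n f c); [exact: cyc_smap hc | rewrite subrr].
- move=> c hc; exists (smap n g c); first exact: cyc_smap hc.
  rewrite smap_smap -opprB; apply: (lin_closedN (lin_closed_bnd n hT)).
  have := homotopy_bnd hH hc; congr (bnd _ _ _ (_ - _)).
    apply: eq_lext hc.1 => s [_ Us]; congr << _ >>; apply/funext => x /=; exact: H1.
  by apply: smap_id hc.1.
- move=> c c' hc hc' hr; split => hb.
    rewrite -(subrK (smap n f c) c'); apply: (lin_closedD (lin_closed_bnd n hT) hr).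
    exact: bnd_smap hb.
  have : bnd (dsing T) (sch T U) n (smap n f c).
    rewrite -(subKr c' (smap n f c)); exact: (lin_closedB (lin_closed_bnd n hT) hb hr).
  move/(bnd_smap hg); rewrite smap_smap; congr (bnd _ _ _ _).
  by apply: smap_id hc.1.
Qed.

Lemma chi_homotopy_equiv T P (U : set T) (W : set P) (f : P -> T) (g : T -> P)
    (H : T -> R -> T) e :
  cont_on W U f -> cont_on U W g -> (forall x, W x -> g (f x) = x) ->
  cont_homotopy U U H -> (forall z, U z -> H z 0 = z) -> (forall z, U z -> H z 1 = f (g z)) ->
  chi W e -> chi U e.
Proof.
move=> hf hg gf hH H0 H1 [N [ds [hd ds0 ->]]].
by exists N, ds; split => // n; exact: (hdim_homotopy_equiv hf hg gf hH H0 H1).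
Qed.

End Homotopy.

(** * Barycentric subdivision and small simplices *)

Section Subdivision.

Definition sd_chain n : achain n (model n) := residue (slice 0) n.

(** Quantifying over an arbitrary affine function, given by its values [v] at the vertices with
    oscillation at most [D], makes the estimate pass to faces and to every affine image of the
    simplex. *)
Definition small_spread n : set ('I_n.+1 -> model n) := [set w | in_model w /\
  forall (v : 'I_n.+1 -> R^o) (D : R), (forall i j, `|v i - v j| <= D) ->
    forall i j, `|comb (w i).1 v - comb (w j).1 v| <= n%:R / n.+1%:R * D].
Arguments small_spread : clear implicits.

(** The barycenter minus vertex [j] averages [n + 1] differences [v i - v j], one of which vanishes;
    hence the factor n / (n + 1). A general point is an average of vertices. *)
Lemma bary_spread n (v : 'I_n.+1 -> R^o) (D : R) x : (forall i j, `|v i - v j| <= D) ->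
  Delta n x -> `|comb (bary n) v - comb x v| <= n%:R / n.+1%:R * D.
Proof.
move=> hv [x0 x1].
have hb j : `|comb (bary n) v - v j| <= n%:R / n.+1%:R * D.
  have -> : comb (bary n) v - v j = \sum_i n.+1%:R^-1 * (v i - v j).
    rewrite -mulr_sumr sumrB sumr_const card_ord mulrBr -(mulr_natl (v j)) mulKf ?pnatr_eq0 //.
    by rewrite /comb mulr_sumr; congr (_ - _); apply: eq_bigr => i _; rewrite mxE.
  apply: le_trans (ler_norm_sum _ _ _) _.
  rewrite (bigD1 j) //= subrr mulr0 normr0 add0r.
  apply: (@le_trans _ _ (\sum_(i | i != j) n.+1%:R^-1 * D)).
    apply: ler_sum => i _; rewrite normrM ger0_norm ?invr_ge0 //.
    by rewrite ler_wpM2l ?invr_ge0.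
  by rewrite sumr_const cardC1 card_ord /= -(mulr_natl (_ * D)) mulrA.
have -> : comb (bary n) v - comb x v = \sum_j x 0 j * (comb (bary n) v - v j).
  by under [RHS]eq_bigr do rewrite mulrBr; rewrite sumrB -mulr_suml x1 mul1r.
apply: le_trans (ler_norm_sum _ _ _) _.
rewrite (_ : n%:R / n.+1%:R * D = \sum_j x 0 j * (n%:R / n.+1%:R * D)); last first.
  by rewrite -mulr_suml x1 mul1r.
apply: ler_sum => j _.
by rewrite normrM ger0_norm // ler_wpM2l.
Qed.

(** By [residueS] the simplices are cones from the barycenter over subdivided faces: an edge either
    lies in a face, where induction applies, or ends at the barycenter, where [bary_spread] does. *)
Lemma sd_small_spread n : supp_in (small_spread n) (sd_chain n).
Proof.
elim: n => [|n IH].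
  rewrite /sd_chain residue0; apply: (lin_closedZ _ (@lin_closed_supp_in rat _ _)).
  apply: supp_inU; split => [i|v D hv i j]; first exact: Delta_bary.
  by rewrite subrr normr0 mul0r mul0r.
rewrite /sd_chain residueS; last exact: abd_slice.
pose spread' : set ('I_n.+1 -> model n.+1) := [set w | in_model w /\
  forall (v : 'I_n.+2 -> R^o) (D : R), (forall i j, `|v i - v j| <= D) ->
    forall i j, `|comb (w i).1 v - comb (w j).1 v| <= n.+1%:R / n.+2%:R * D].
have hn : supp_in spread' (natd (sd_chain n)).
  have hS := @lin_closed_supp_in rat _ spread'.
  rewrite natdE; apply: (lin_closed_sum _ hS) => k _; apply: (lin_closedZ _ hS).
  apply: (supp_in_lext hS _ IH) => w [wm hw]; apply: supp_inU; split => [i|v D hv i j].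
    by apply: Delta_comb => // l; exact: Delta_std.
  have cE i' : comb ((afmap (@std n.+1 \o lift k) \o w) i').1 v = comb (w i').1 (v \o lift k).
    by rewrite /= comb_comb /=; congr comb; apply/funext => l; rewrite comb_std.
  rewrite !cE; apply: le_trans (hw _ D _ i j) _; first by move=> *; exact: hv.
  (* The ratio n / (n + 1) increases with [n], so the bound inherited from a face is good enough. *)
  apply: ler_wpM2r; first by have := hv ord0 ord0; rewrite subrr normr0.
  by rewrite ler_pdivrMr // mulrAC ler_pdivlMr // -!natrM ler_nat; nia.
apply: (supp_in_lext (@lin_closed_supp_in rat _ _) _ hn) => w [wm hw].
apply: supp_inU; split => [i|v D hv i j].
  by rewrite /pcons; case: unlift => [k|] //=; exact: Delta_bary.
have D0 : 0 <= n.+1%:R / n.+2%:R * D.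
  by rewrite mulr_ge0 ?divr_ge0 //; have := hv ord0 ord0; rewrite subrr normr0.
rewrite /pcons; case: (unlift _ i) => [k|]; case: (unlift _ j) => [l|] /=.
- exact: hw.
- by rewrite distrC; apply: bary_spread.
- exact: bary_spread.
- by rewrite subrr normr0.
Qed.

End Subdivision.

(** * Small chains and Mayer-Vietoris for open sets *)

Section SmallSimplices.
Implicit Types T : topologicalType.

Definition sd n T : {linear schain n T -> schain n T} := natop (sd_chain n) (fun z _ => z).

Definition sdh n T : {linear schain n T -> schain n.+1 T} :=
  natop (fill (slice 0) n) (fun z _ => z).

Lemma natop_slice0 n T (c : schain n T) : natop (slice 0 n) (fun z _ => z) c = c.
Proof.
by apply: (@eq_lin _ _ _ (natop (slice 0 n) (fun z _ => z)) idfun) => s; rewrite natop_slice.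
Qed.

Lemma sdhS n T c : dsing T n.+1 (sdh n.+1 T c) + sdh n T (dsing T n c) = c - sd n.+1 T c.
Proof.
have := natop_fill (T' := T) (fun z _ => z) c (fun k => @supp_in_slice 0 k).
by rewrite natop_slice0.
Qed.

Lemma sdh0 T c : dsing T 0 (sdh 0 T c) = c - sd 0 T c.
Proof.
by have := natop_fill0 (slice 0) (T' := T) (fun z _ => z) c; rewrite natop_slice0.
Qed.

Lemma sch_sd T (U : set T) n c : sch T U n c -> sch T U n (sd n T c).
Proof.
apply: sch_natop; first exact: cont_homotopy_fst.
by apply: sub_supp_in (@sd_small_spread n) => w [].
Qed.

Lemma sch_sdh T (U : set T) n c : sch T U n c -> sch T U n.+1 (sdh n T c).
Proof.
apply: sch_natop; first exact: cont_homotopy_fst.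
by apply: supp_in_fill => k; exact: supp_in_slice.
Qed.

(** Affine pieces of one fixed [s], with vertices in the domain of [s], so that after any number of
    subdivisions the Lebesgue number of [s] still applies. *)
Definition spread n T (s : Delta n -> T) (e : R) : set (Delta n -> T) :=
  [set s' | exists w : 'I_n.+1 -> 'rV[R]_n.+1, [/\ forall i, Delta n (w i),
    forall i j l, `|w i 0 l - w j 0 l| <= e & s' = real (hat s) w]].

Lemma supp_in_spread_sd n T (s : Delta n -> T) e c : supp_in (spread s e) c ->
  supp_in (spread s (n%:R / n.+1%:R * e)) (sd n T c).
Proof.
move=> hc; have hS := @lin_closed_supp_in rat _ (spread s (n%:R / n.+1%:R * e)).
apply: (supp_in_lext hS _ hc) => _ [w [wD we ->]].
apply: (supp_in_lext hS _ (@sd_small_spread n)) => v [vm hv].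
apply: supp_inU; exists (fun i => comb (v i).1 w); split.
- by move=> i; exact: Delta_comb.
(* Each coordinate of [w] gives an affine function, to which the estimate in [small_spread]
   applies. *)
- by move=> i j l; rewrite !comb_coord; apply: hv => i' j'; exact: we.
- apply/funext => x; rewrite /real {1}/hat comb_fst DptK ?comb_comb //.
  by apply: Delta_comb => //; exact: Delta_set_val.
Qed.

Lemma spread_self n T (s : Delta n -> T) : spread s 1 s.
Proof.
exists (@std n); split => [i|i j l|]; first exact: Delta_std.
  rewrite !mxE eqxx /=; case: (l == i); case: (l == j);
    by rewrite /= ?subrr ?subr0 ?sub0r ?normrN ?normr0 ?normr1.
by apply/funext => x; rewrite /real comb_id /hat set_valK.
Qed.

Lemma sset_spread n T (s : Delta n -> T) (U : set T) (w : 'I_n.+1 -> 'rV[R]_n.+1) :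
  continuous s -> (forall i, Delta n (w i)) ->
  (forall x : Delta n, U (hat s (comb (set_val x) w))) -> sset U (real (hat s) w).
Proof.
move=> cs wD hU; split => // x.
apply: (@continuous_comp _ _ _ (fun x : Delta n => Dpt (comb (set_val x) w)) s).
  exact: continuous_affine.
exact: cs.
Qed.

Lemma comb_near n (w : 'I_n.+1 -> 'rV[R]_n.+1) e x l :
  (forall i j l, `|w i 0 l - w j 0 l| <= e) -> Delta n x ->
  `|w ord0 0 l - comb x w 0 l| <= e.
Proof.
move=> we [x0 x1].
have -> : w ord0 0 l - comb x w 0 l = \sum_j x 0 j * (w ord0 0 l - w j 0 l).
  under [RHS]eq_bigr do rewrite mulrBr; rewrite sumrB -mulr_suml x1 mul1r comb_coord.
  by rewrite /comb.
apply: le_trans (ler_norm_sum _ _ _) _.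
rewrite (_ : e = \sum_j x 0 j * e); last by rewrite -mulr_suml x1 mul1r.
by apply: ler_sum => j _; rewrite normrM ger0_norm // ler_wpM2l.
Qed.

Lemma pow_ratio_small n (e : R) : 0 < e -> exists k, (n%:R / n.+1%:R) ^+ k < e.
Proof.
move=> e0; have h1 : `|n%:R / n.+1%:R : R| < 1.
  by rewrite ger0_norm ?divr_ge0 // ltr_pdivrMr // mul1r ltr_nat.
have /(@cvgr_dist_lt R R^o) /(_ e e0) [N _ hN] := cvg_expr h1.
exists N; have := hN N (leqnn N); rewrite /= sub0r normrN ger0_norm //.
Qed.

Variables (T : topologicalType) (A B : set T).
Hypotheses (oA : open A) (oB : open B).

Definition small n : set (schains T n) :=
  [set c | exists a b, [/\ sch T A n a, sch T B n b & c = a + b]].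
Arguments small : clear implicits.

Lemma subcomplex_small : subcomplex (dsing T) small.
Proof. by apply: subcomplexD; exact: subcomplex_sch. Qed.

Let lin_small n : lin_closed (small n) := subcomplex_small.1 n.

Lemma small_sd n c : small n c -> small n (sd n T c).
Proof.
move=> [a [b [ha hb ->]]]; exists (sd n T a), (sd n T b).
by rewrite linearD; split => //; exact: sch_sd.
Qed.

Lemma small_sdh n c : small n c -> small n.+1 (sdh n T c).
Proof.
move=> [a [b [ha hb ->]]]; exists (sdh n T a), (sdh n T b).
by rewrite linearD; split => //; exact: sch_sdh.
Qed.

Lemma iter_sd_linear n k a u v :
  iter k (sd n T) (a *: u + v) = a *: iter k (sd n T) u + iter k (sd n T) v.
Proof. by elim: k => //= k ->; rewrite linearP. Qed.

Lemma small_iter_sd n k c : small n c -> small n (iter k (sd n T) c).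
Proof. by move=> hc; elim: k => //= k; exact: small_sd. Qed.

Lemma small_spread_supp n (s : Delta n -> T) r e c : continuous s -> r < e ->
  (forall x, Delta n x ->
    (forall y, Delta n y -> (forall l, `|x 0 l - y 0 l| < e) -> A (hat s y)) \/
    (forall y, Delta n y -> (forall l, `|x 0 l - y 0 l| < e) -> B (hat s y))) ->
  supp_in (spread s r) c -> small n c.
Proof.
move=> cs re hleb; apply: (supp_in_ind (lin_small n)) => _ [w [wD wr ->]].
have near0 (x : Delta n) l : `|w ord0 0 l - comb (set_val x) w 0 l| < e.
  by apply: le_lt_trans re; apply: comb_near wr _; exact: Delta_set_val.
have inD (x : Delta n) : Delta n (comb (set_val x) w).
  by apply: Delta_comb => //; exact: Delta_set_val.
case: (hleb _ (wD ord0)) => h.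
  exists << real (hat s) w >>, 0; rewrite addr0; split => //.
    by apply: supp_inU; apply: sset_spread => // x; exact: h.
  by case: (lin_closed_sch B n).
exists 0, << real (hat s) w >>; rewrite add0r; split => //.
  by case: (lin_closed_sch A n).
by apply: supp_inU; apply: sset_spread => // x; exact: h.
Qed.

(** A single simplex needs the number [k] of subdivisions that brings (n / (n + 1))^k below its
    Lebesgue number. Sums are harmless, since a small chain stays small under further
    subdivision. *)
Lemma iter_sd_small n c : sch T (A `|` B) n c -> exists k, small n (iter k (sd n T) c).
Proof.
apply: (@supp_in_ind _ _ _ [set c | exists k, small n (iter k (sd n T) c)]).
  split.
    by exists 0%N => /=; case: (lin_small n).
  move=> a u v [k hk] [l hl]; exists (k + l)%N; rewrite iter_sd_linear.
  apply: (lin_small n).2; last by rewrite iterD; exact: small_iter_sd.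
  by rewrite addnC iterD; exact: small_iter_sd.
move=> s [cs sAB].
have [e e0 hleb] := lebesgue_number cs oA oB sAB.
have [k hk] := pow_ratio_small n e0; exists k.
apply: (small_spread_supp cs hk hleb).
elim: k {hk} => [|k IH] /=; first by apply: supp_inU; rewrite expr0; exact: spread_self.
by rewrite exprS; exact: supp_in_spread_sd.
Qed.

(** Surjectivity on homology of the inclusion of small chains: subdivision changes a cycle by a
    boundary, through the homotopy [sdh], and is iterated until the cycle is small. *)
Lemma small_cycle n c : cyc (dsing T) (sch T (A `|` B)) n c ->
  exists2 c', cyc (dsing T) small n c' & bnd (dsing T) (sch T (A `|` B)) n (c - c').
Proof.
move=> hc; have [k hk] := iter_sd_small hc.1.
elim: k c hc hk => [|k IH] c hc hk.
  exists c; last by rewrite subrr; case: (lin_closed_bnd n (subcomplex_sch (A `|` B))).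
  by split => //; case: hc.
have hb : bnd (dsing T) (sch T (A `|` B)) n (c - sd n T c).
  exists (sdh n T c); first by apply: sch_sdh; case: hc.
  case: n c hc {hk IH} => [|n] c [hc cc]; first by rewrite sdh0.
  by rewrite -sdhS (_ : dsing T n c = 0) // linear0 addr0.
have hsd : cyc (dsing T) (sch T (A `|` B)) n (sd n T c).
  rewrite -(subKr c (sd n T c)); apply: (lin_closedB (lin_closed_cyc n (subcomplex_sch _))) => //.
  exact: (bnd_cyc (@dsing_dsing T) (subcomplex_sch _) hb).
have [||c' hc' hcc'] := IH (sd n T c) => //.
  by rewrite -iterSr.
exists c' => //; rewrite -(subrK (sd n T c) c) -addrA.
exact: (lin_closedD (lin_closed_bnd n (subcomplex_sch _))).
Qed.

(** Injectivity on homology. Here [dsing b = dsing (sd b) + dsing (sdh (dsing b))], and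
    [sdh (dsing b)] is small because [dsing b] is; so [b] may be replaced by [sd b] until it is
    small. *)
Lemma small_bnd n b : sch T (A `|` B) n.+1 b -> small n (dsing T n b) ->
  bnd (dsing T) small n (dsing T n b).
Proof.
move=> hb; have [k hk] := iter_sd_small hb.
elim: k b hb hk => [|k IH] b hb hk sb; first by exists b.
have bE : dsing T n b = dsing T n (sd n.+1 T b) + dsing T n (sdh n T (dsing T n b)).
  have := congr1 (dsing T n) (sdhS b); rewrite linearD linearB dsing_dsing add0r.
  by move=> ->; rewrite addrC subrK.
have h2 : bnd (dsing T) small n (dsing T n (sdh n T (dsing T n b))).
  by exists (sdh n T (dsing T n b)) => //; exact: small_sdh.
rewrite bE; apply: (lin_closedD (lin_closed_bnd n subcomplex_small)) => //.
apply: IH; [exact: sch_sd | by rewrite -iterSr |].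
have -> : dsing T n (sd n.+1 T b) = dsing T n b - dsing T n (sdh n T (dsing T n b)) by rewrite {1}bE addrK.
apply: (lin_closedB (lin_small n)) => //; apply: subcomplex_small.2; exact: small_sdh.
Qed.

Lemma hdim_small n d : hdimc (dsing T) small n d -> hdimc (dsing T) (sch T (A `|` B)) n d.
Proof.
have hS := subcomplex_small; have hT := subcomplex_sch (A `|` B).
have lT := lin_closed_bnd n hT.
have sub m : small m `<=` sch T (A `|` B) m.
  move=> _ [a [b [ha hb ->]]]; apply: (lin_closedD (lin_closed_sch _ m)).
    by apply: sub_sch ha; exact: subsetUl.
  by apply: sub_sch hb; exact: subsetUr.
have subb c : bnd (dsing T) small n c -> bnd (dsing T) (sch T (A `|` B)) n c.
  by move=> [b hb ->]; exists b => //; exact: sub.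
apply: (@qdim_rel _ _ _ _ _ _ _ (fun c c' => bnd (dsing T) (sch T (A `|` B)) n (c' - c))).
- exact: lin_closed_cyc.
- exact: lin_closed_cyc.
- by move=> a u v u' v' hu hv; rewrite opprD addrACA -scalerBr; exact: lT.2.
- by rewrite subrr; exact: lT.1.
- move=> c [hc cc]; exists c; last by rewrite subrr; exact: lT.1.
  by split => //; exact: sub.
- by move=> c hc; have [c' hc' h] := small_cycle hc; exists c'.
- move=> c c' [hc _] _ hr; split => hb.
    by rewrite -(subrK c c'); apply: (lin_closedD lT) => //; exact: subb.
  have : bnd (dsing T) (sch T (A `|` B)) n c by rewrite -(subKr c' c); exact: (lin_closedB lT).
  by move=> [b sb e]; rewrite e; apply: small_bnd => //; rewrite -e.
Qed.

Lemma chi_mayer_vietoris eA eB eAB :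
  chi A eA -> chi B eB -> chi (A `&` B) eAB -> chi (A `|` B) (eA + eB - eAB).
Proof.
move=> hA hB hAB.
have hI : (fun n => sch T A n `&` sch T B n) = sch T (A `&` B).
  apply: functional_extensionality_dep => n; rewrite eqEsubset; split => c.
    by move=> [ha hb] s hs; have [? ?] := ha s hs; have [_ ?] := hb s hs; split.
  by move=> hc; split; apply: sub_sch hc; [exact: subIsetl | exact: subIsetr].
have [N [ds [hd h0 ->]]] : euler (dsing T) small (eA + eB - eAB).
  apply: euler_mayer_vietoris => //; [exact: dsing_dsing|exact: subcomplex_sch|exact: subcomplex_sch|].
  by rewrite hI.
by exists N, ds; split => // n; exact: hdim_small.
Qed.

End SmallSimplices.

(** * Finite spaces and the Euler characteristic *)

Section BasicSpaces.
Variable T : topologicalType.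
Implicit Types (U : set T) (z : T).

Lemma chi_empty U : (forall z, ~ U z) -> chi U 0.
Proof.
move=> U0; exists 0%N, (fun=> 0%N); split => //; last by rewrite big_ord0.
move=> n; apply: qdim0 => c [hc _].
have -> : c = 0.
  apply/eqP/freeg_eqP => s; rewrite coeff0.
  by have [//|/hc [_ /(_ (Dpt (std ord0))) /U0]] := eqVneq (coeff s c) 0.
exact: (lin_closed_bnd n (subcomplex_sch _)).1.
Qed.

Lemma sch_point z n c : sch T [set z] n c ->
  c = coeff (cst z) c *: << cst z : Delta n -> T >>.
Proof.
move=> hc; apply/eqP/freeg_eqP => s; rewrite coeffZ coeffU mul1r.
have [->|sz] := eqVneq (cst z) s; first by rewrite mulr1.
rewrite mulr0; have [//|/hc [_ hs]] := eqVneq (coeff s c) 0.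
by case/eqP: sz; apply/funext => x; rewrite -(hs x).
Qed.

Lemma sset_point z n : sset [set z] (cst z : Delta n -> T).
Proof. by split => // x; exact: cst_continuous. Qed.

Lemma dsing_point z n :
  dsing T n << cst z : Delta n.+1 -> T >> = (odd n)%:R *: << cst z : Delta n -> T >>.
Proof.
rewrite [LHS]sbdU.
under eq_bigr do rewrite (_ : cst z \o _ = (cst z : Delta n -> T)) //.
rewrite -scaler_suml; congr (_ *: _).
elim: n => [|n IH]; first by rewrite big_ord_recl big_ord1 expr0 expr1 subrr.
by rewrite big_ord_recr /= IH exprS exprS mulrA mulrNN !mul1r -signr_odd; case: (odd n);
  rewrite ?expr1 ?expr0 ?subrr ?add0r.
Qed.

(** There is one simplex in each degree, and the boundary maps alternate between 0 and the identity,
    beginning with 0. *)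
Lemma chi_point z : chi [set z] 1.
Proof.
have hS := subcomplex_sch [set z].
have hU n : sch T [set z] n << cst z >> by apply: supp_inU; exact: sset_point.
exists 1%N, (fun n => (n == 0)%N : nat); split; last by rewrite big_ord1.
  case=> [|n].
    exists (fun=> << cst z >>); split => [k|c [hc _]|a].
    - by split.
    - exists (const_mx (coeff (cst z) c)); rewrite /comb big_ord1 mxE -(sch_point hc) subrr.
      exact: (lin_closed_bnd 0 hS).1.
    - move=> [b hb]; rewrite /comb big_ord1 (sch_point hb) linearZ /= dsing_point.
      rewrite scale0r scaler0 => /(congr1 (coeff (cst z))).
      rewrite coeffZ coeffU eqxx !mulr1 coeff0 => a0.
      by apply/rowP => i; rewrite ord1 mxE a0.
  apply: qdim0 => c [hc]; rewrite (sch_point hc) => cc.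
  have {cc} : dsing T n (coeff (cst z) c *: << cst z >>) = 0 := cc.
  rewrite linearZ /= dsing_point; case en : (odd n) => cc.
    rewrite -[X in bnd _ _ _ X]/(_ *: _) (_ : coeff (cst z) c = 0); last first.
      have := congr1 (coeff (cst z)) cc.
      by rewrite !coeffZ coeffU eqxx !mulr1 coeff0.
    by rewrite scale0r; exact: (lin_closed_bnd n.+1 hS).1.
  exists (coeff (cst z) c *: << cst z >>); first exact: lin_closedZ (lin_closed_sch _ _) (hU _).
  by rewrite linearZ /= dsing_point /= en scale1r.
by case.
Qed.

(** A finite Hausdorff space is discrete, so its points can be added one at a time by
    Mayer-Vietoris. *)
Lemma chi_finite : hausdorff_space T -> finite_set [set: T] -> exists e, chi [set: T] e.
Proof.
move=> hT fT.
have allopen U : open U.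
  rewrite -(setCK U) openC; apply: (accessible_finite_set_closed.1 (hausdorff_accessible hT)).
  exact: sub_finite_set fT.
have [s ->] := (finite_seqP _).1 fT.
elim: s => [|x s [e IH]].
  by exists 0; exact: chi_empty.
have -> : [set` x :: s] = [set x] `|` [set` s].
  apply/seteqP; split => y /=; rewrite in_cons; first by case/orP => [/eqP|]; [left|right].
  by case=> [->|->]; rewrite ?eqxx ?orbT.
have [f hf] : exists f, chi ([set x] `&` [set` s]) f.
  (* The enumeration may repeat a point, in which case the intersection is that point instead of
     being empty. *)
  have [xs|xs] := boolP (x \in s).
    exists 1; rewrite (_ : _ `&` _ = [set x]); first exact: chi_point.
    by apply: setIidl => y /= ->.
  exists 0; apply: chi_empty => y [/= -> h].
  by rewrite h in xs.
by exists (1 + e - f); apply: chi_mayer_vietoris => //; exact: chi_point.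
Qed.

(** * Comparison with chains written as lists of terms *)

Definition to_freeg n (c : chain n T) : schain n T := \sum_(p <- c) p.1 *: << p.2 >>.

Lemma coeff_to_freeg n (c : chain n T) s : coeff s (to_freeg c) = coef c s.
Proof.
rewrite /to_freeg /coef raddf_sum; apply: eq_bigr => p _ /=.
rewrite coeffZ coeffU mul1r; case: asboolP => [->|ps]; first by rewrite eqxx mulr1.
by case: eqVneq => [/ps //|_]; rewrite mulr0.
Qed.

Lemma to_freeg_eqP n (c c' : schain n T) : (forall s, coeff s c = coeff s c') -> c = c'.
Proof. by move=> h; apply/eqP/freeg_eqP => s; exact: h. Qed.

Lemma to_freeg_bd n (c : chain n.+1 T) : to_freeg (bd c) = sbd n T (to_freeg c).
Proof.
rewrite /to_freeg linear_sum /bd big_flatten /= big_map; apply: eq_bigr => p _.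
rewrite linearZ /= sbdU scaler_sumr big_map big_enum /=; apply: eq_bigr => i _.
by rewrite scalerA mulrC.
Qed.

Lemma sch_to_freeg n (c : chain n T) : sing_chain c -> sch T setT n (to_freeg c).
Proof.
have [h0 hl] := lin_closed_sch [set: T] n; rewrite /to_freeg.
elim: c => [|p c IH] hc; first by rewrite big_nil.
rewrite big_cons; have [hp hc'] : continuous p.2 /\ sing_chain c by inversion hc.
by apply: hl; [exact: supp_inU | exact: IH].
Qed.

Lemma to_freeg_surj n (c : schain n T) : sch T setT n c ->
  exists2 c' : chain n T, sing_chain c' & to_freeg c' = c.
Proof.
move=> hc; exists [seq (coeff s c, s) | s <- dom c]; last first.
  rewrite /to_freeg big_map /= -[RHS]freeg_sumE; apply: eq_bigr => s _.
  by apply: to_freeg_eqP => s'; rewrite coeffZ !coeffU mul1r.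
have gen r : {subset r <= dom c} -> sing_chain [seq (coeff s c, s) | s <- r].
  elim: r => [|s r IH] hr /=; first by constructor.
  constructor => /=; last by apply: IH => t tr; apply: hr; rewrite in_cons tr orbT.
  by have := hr s (mem_head _ _); rewrite mem_dom => /hc [].
exact: gen.
Qed.

Lemma cycle_to_freeg n (c : chain n T) :
  Defs.cycle c <-> sing_chain c /\ is_cyc (dsing T) (to_freeg c).
Proof.
case: n c => [|n] c; first by split => [|[]].
split=> -[hc h]; split => //.
  apply: to_freeg_eqP => s; rewrite -[dsing T n _]to_freeg_bd coeff_to_freeg h.
  by rewrite coeff0.
by move=> s; rewrite -coeff_to_freeg to_freeg_bd [sbd n T _]h coeff0.
Qed.

Lemma cyc_to_freeg n (c : chain n T) : Defs.cycle c -> cyc (dsing T) (sch T setT) n (to_freeg c).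
Proof. by move=> /cycle_to_freeg [hc h]; split => //; exact: sch_to_freeg. Qed.

Lemma coeff_comb n d (a : 'rV[rat]_d) (z : 'I_d -> chain n T) s :
  coeff s (comb a (fun k => to_freeg (z k))) = \sum_(k < d) a 0 k * coef (z k) s.
Proof.
by rewrite /comb raddf_sum; apply: eq_bigr => k _ /=; rewrite coeffZ coeff_to_freeg.
Qed.

(** A basis modulo boundaries spans, and [qdim_min] shows that no shorter family does; this is the
    minimality demanded by [hdim]. *)
Lemma hdim_of_hdimc n d : hdimc (dsing T) (sch T setT) n d -> hdim n T d.
Proof.
move=> hd; split.
  have [z [hz zspan _]] := hd.
  have /choice [y hy] : forall k, exists c : chain n T, Defs.cycle c /\ to_freeg c = z k.
    move=> k; have [sz cz] := hz k; have [c hc e] := to_freeg_surj sz.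
    by exists c; split => //; apply/cycle_to_freeg; rewrite e.
  exists y; split => [k|c /cyc_to_freeg hc]; first by case: (hy k).
  have [a [b hb hab]] := zspan _ hc; have [b' sb' eb] := to_freeg_surj hb.
  exists (fun k => a 0 k), b'; split => // s.
  rewrite -coeff_comb -!coeff_to_freeg to_freeg_bd eb.
  have -> : (fun k => to_freeg (y k)) = z by apply/funext => k; case: (hy k).
  by rewrite -coeffD -[sbd n T b]hab addrC subrK.
move=> d' [z [hz hspan]].
apply: (qdim_min (z' := fun k => to_freeg (z k)) (lin_closed_bnd n (subcomplex_sch _)) hd).
move=> c [sc cc]; have [c' sc' ec] := to_freeg_surj sc.
have [|a [b [sb hab]]] := hspan c'; first by apply/cycle_to_freeg; rewrite ec.
exists (\row_k a k); exists (to_freeg b); first exact: sch_to_freeg.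
rewrite -[dsing T n _]to_freeg_bd -ec; apply/eqP; rewrite subr_eq; apply/eqP.
apply: to_freeg_eqP => s; rewrite coeffD coeff_comb !coeff_to_freeg hab addrC.
by congr (_ + _); apply: eq_bigr => k _; rewrite mxE.
Qed.

Lemma euler_char_of_chi e : chi [set: T] e -> euler_char T e.
Proof.
move=> [N [ds [hd h0 ->]]]; exists N; split => [n Nn|].
  by rewrite -(h0 n Nn); exact: hdim_of_hdimc.
by exists ds; split => // n _; exact: hdim_of_hdimc.
Qed.

End BasicSpaces.

(** * Fibrous decompositions *)

Definition clamp (a b t : R) : R := Num.min b (Num.max a t).

Lemma clampE a b t : a <= t <= b -> clamp a b t = t.
Proof. by move=> /andP [at_ tb]; rewrite /clamp max_r // min_r. Qed.

Lemma clamp_in a b t : a <= b -> a <= clamp a b t <= b.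
Proof. by move=> ab; rewrite /clamp le_min ab le_max lexx ge_min lexx. Qed.

Lemma continuous_clamp a b : continuous (clamp a b).
Proof.
move=> t; apply: (@continuous_min R R (cst b) (fun t => Num.max a t)).
  exact: cst_continuous.
by apply: (@continuous_max R R (cst a) id); [exact: cst_continuous | exact: cvg_id].
Qed.

Lemma lerp_between (u c k : R) : 0 <= k <= 1 ->
  Num.min u c <= u + k * (c - u) <= Num.max u c.
Proof.
move=> /andP [k0 k1]; case: (leP u c) => uc; apply/andP; split; nra.
Qed.

Lemma tube (P : topologicalType) (a : P) (K : set R) (Q : P -> R -> Prop) : compact K ->
  (forall s, K s -> nbhs (a, s) [set p : P * R | Q p.1 p.2]) ->
  nbhs a [set a' | forall s, K s -> Q a' s].
Proof.
move=> /compact_near_coveringP cov hQ.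
apply: (cov P (nbhs a) (fun a' s => Q a' s)) => s Ks.
have [[V W] /= [aV sW] VW] := hQ s Ks.
by exists (W, V) => //= -[s' a'] /= [? ?]; exact: (VW (a', s')).
Qed.

(** * Height, slabs and their deformation in a space glued from cylinders *)

Section Gluing.
Variables (Z : topologicalType) (n : nat) (X Y : nat -> topologicalType).
Variables (fl : forall i, Y i -> X i) (fu : forall i, Y i.+1 -> X i).
Variables (qX : forall i, X i -> Z) (qY : forall j, Y j -> R -> Z).
Arguments fl : clear implicits.
Arguments fu : clear implicits.
Arguments qX : clear implicits.
Arguments qY : clear implicits.

Definition cell j (t : R) := j%:R - 1 <= t <= j%:R.

(* [qY j] is junk outside [j - 1, j]; clamping makes it continuous on Y_j x R. *)
Definition qc j (p : Y j * R) : Z := qY j p.1 (clamp (j%:R - 1) j%:R p.2).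

Hypothesis fl_cont : forall j, (1 <= j <= n)%N -> continuous (fl j).
Hypothesis fu_cont : forall i, (i < n)%N -> continuous (fu i).
Hypothesis glue_lower : forall j y, (1 <= j <= n)%N -> qY j y j%:R = qX j (fl j y).
Hypothesis glue_upper : forall i y, (i < n)%N -> qY i.+1 y i%:R = qX i (fu i y).
Hypothesis glue_surj : forall z,
  (exists i a, (i <= n)%N /\ z = qX i a) \/
  (exists j y t, [/\ (1 <= j <= n)%N, cell j t & z = qY j y t]).
Hypothesis glue_injX : forall i a b, (i <= n)%N -> qX i a = qX i b -> a = b.
Hypothesis glue_injY : forall j y y' t, (1 <= j <= n)%N -> j%:R - 1 < t < j%:R ->
  qY j y t = qY j y' t -> y = y'.
(** The universal property of the quotient set; continuity of the resulting maps is settled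
    separately by [glue_continuous]. *)
Hypothesis glue_desc : forall (W : Type) (gX : forall i, X i -> W) (gY : forall j, Y j -> R -> W),
  (forall j y, (1 <= j <= n)%N -> gY j y j%:R = gX j (fl j y)) ->
  (forall i y, (i < n)%N -> gY i.+1 y i%:R = gX i (fu i y)) ->
  exists G : Z -> W, (forall i a, (i <= n)%N -> G (qX i a) = gX i a) /\
    (forall j y t, (1 <= j <= n)%N -> cell j t -> G (qY j y t) = gY j y t).
Hypothesis glue_open : forall U : set Z, (forall i, (i <= n)%N -> open (qX i @^-1` U)) ->
  (forall j, (1 <= j <= n)%N -> open (@qc j @^-1` U)) -> open U.
Hypothesis qX_cont : forall i, (i <= n)%N -> continuous (qX i).
Hypothesis qc_cont : forall j, (1 <= j <= n)%N -> continuous (@qc j).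

Lemma cell_clamp j t : cell j (clamp (j%:R - 1) j%:R t).
Proof. by apply: clamp_in; rewrite gerBl. Qed.

Lemma qcE j y t : cell j t -> qc (y, t) = qY j y t.
Proof. by move=> ht; rewrite /qc /= clampE. Qed.

(* Since closed intervals are compact, the product of the quotient map with
   the identity of [R] is again a quotient map. *)
Lemma glue_continuous (W : topologicalType) (U : set Z) (G : Z -> R -> W) : open U ->
  (forall i a s, (i <= n)%N -> U (qX i a) ->
     {for (a, s), continuous (fun p : X i * R => G (qX i p.1) p.2)}) ->
  (forall j p s, (1 <= j <= n)%N -> U (@qc j p) ->
     {for (p, s), continuous (fun p : (Y j * R) * R => G (qc p.1) p.2)}) ->
  forall z s, U z -> {for (z, s), continuous (fun p : Z * R => G p.1 p.2)}.
Proof.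
move=> oU hX hY z0 s0 Uz0 N /=; rewrite nbhsE => -[N' [oN' N'z] N'N].
have [d d0 hd] : exists2 d : R, 0 < d & forall s, `[s0 - d, s0 + d]%classic s -> N' (G z0 s).
  have : nbhs s0 [set s | N' (G z0 s)].
    have hs (P : topologicalType) (p : P) (g : P -> Z) :
        {for (p, s0), continuous (fun p : P * R => G (g p.1) p.2)} -> g p = z0 ->
        nbhs s0 [set s | N' (G z0 s)].
      move=> hc pz; rewrite -pz.
      have : {for s0, continuous (fun s => G (g p) s)}.
        apply: (@continuous_comp _ _ _ (fun s : R => (p, s)) (fun p : P * R =>
            G (g p.1) p.2)) => //.
        by apply: continuous_pair; [exact: cst_continuous | exact: cvg_id].
      by apply; apply: open_nbhs_nbhs; rewrite /= pz.
    case: (glue_surj z0) => [[i [a [ni za]]]|[j [y [t [nj ct zt]]]]].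
      by apply: (hs _ a (qX i)) => //; apply: hX => //; rewrite -za.
    apply: (hs _ (y, t) (@qc j)); last by rewrite qcE.
    by apply: hY => //; rewrite qcE // -zt.
  move=> /nbhs_ballP [d /= d0 hd]; exists (d / 2); first by rewrite divr_gt0.
  move=> s; rewrite /= in_itv /= => /andP [h1 h2]; apply: hd; rewrite /ball /=.
  by rewrite ltr_norml; apply/andP; split; lra.
pose K : set R := `[s0 - d, s0 + d]%classic.
have cK : compact K by exact: segment_compact.
(* The points of [U] whose whole trajectory over the time interval [K] stays in [N']. By the tube
   lemma the pullbacks of [V] to the pieces are open, hence [V] is open in [Z]. *)
pose V : set Z := U `&` [set z | forall s, K s -> N' (G z s)].
have openV (P : topologicalType) (g : P -> Z) : continuous g ->
    (forall p s, U (g p) -> {for (p, s), continuous (fun p : P * R => G (g p.1) p.2)}) ->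
    open (g @^-1` V).
  move=> gc hc; rewrite openE => p [Ugp hp]; rewrite /interior.
  apply: filterI.
    by apply: (gc p U); apply: open_nbhs_nbhs.
  apply: tube => // s Ks; apply: (hc p s Ugp).
  by apply: open_nbhs_nbhs; split => //; exact: hp.
have oV : open V.
  apply: glue_open => [i ni|j nj]; apply: openV.
  - exact: qX_cont.
  - by move=> a s; exact: hX.
  - exact: qc_cont.
  - by move=> p s; exact: hY.
exists (V, `]s0 - d, s0 + d[%classic) => /=.
  split; first by apply: open_nbhs_nbhs; split => //; split.
  apply: open_nbhs_nbhs; split; first exact: interval_open.
  by rewrite /= in_itv /=; apply/andP; split; lra.
move=> [z s] [/= [_ hz]]; rewrite in_itv /= => /andP [h1 h2]; apply: N'N; apply: hz.
by rewrite /K /= in_itv /= !ltW.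
Qed.

Lemma glue_continuous1 (W : topologicalType) (U : set Z) (G : Z -> W) : open U ->
  (forall i a, (i <= n)%N -> U (qX i a) -> {for a, continuous (fun a => G (qX i a))}) ->
  (forall j p, (1 <= j <= n)%N -> U (@qc j p) -> {for p, continuous (fun p => G (@qc j p))}) ->
  forall z, U z -> {for z, continuous G}.
Proof.
move=> oU hX hY z Uz.
have h : {for (z, 0 : R), continuous (fun p : Z * R => G p.1)}.
  apply: (@glue_continuous W U (fun z _ => G z)) => //.
    move=> i a s ni Ua; apply: (@continuous_comp _ _ _ fst (fun a => G (qX i a))).
      exact: cvg_fst.
    exact: hX.
  move=> j p s nj Up; apply: (@continuous_comp _ _ _ fst (fun p => G (@qc j p))).
    exact: cvg_fst.
  exact: hY.
apply: (@continuous_comp _ _ _ (fun z => (z, 0 : R)) (fun p : Z * R => G p.1)) h.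
by apply: continuous_pair; [exact: cvg_id | exact: cst_continuous].
Qed.

Lemma height_ex : exists h : Z -> R, (forall i a, (i <= n)%N -> h (qX i a) = i%:R) /\
  (forall j y t, (1 <= j <= n)%N -> cell j t -> h (qY j y t) = t).
Proof. exact: (@glue_desc R (fun i _ => i%:R) (fun j _ t => t)). Qed.

Definition height := projT1 (cid height_ex).

Lemma heightX i a : (i <= n)%N -> height (qX i a) = i%:R.
Proof. exact: (projT2 (cid height_ex)).1. Qed.

Lemma heightY j y t : (1 <= j <= n)%N -> cell j t -> height (qY j y t) = t.
Proof. exact: (projT2 (cid height_ex)).2. Qed.

Lemma height_qc j p : (1 <= j <= n)%N -> height (@qc j p) = clamp (j%:R - 1) j%:R p.2.
Proof. by move=> nj; rewrite heightY //; exact: cell_clamp. Qed.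

Lemma continuous_clamp_snd j (p : Y j * R) :
  {for p, continuous (fun p : Y j * R => clamp (j%:R - 1) j%:R p.2)}.
Proof.
apply: (@continuous_comp _ _ _ snd (clamp (j%:R - 1) j%:R)); first exact: cvg_snd.
exact: continuous_clamp.
Qed.

Lemma height_cont : continuous height.
Proof.
move=> z; apply: (@glue_continuous1 R setT height openT) => //.
  move=> i a ni _; rewrite (_ : (fun a => _) = cst i%:R); first exact: cst_continuous.
  by apply/funext => b; rewrite heightX.
move=> j p nj _.
rewrite (_ : (fun p => _) = (fun p : Y j * R => clamp (j%:R - 1) j%:R p.2)).
  exact: continuous_clamp_snd.
by apply/funext => b; rewrite height_qc.
Qed.

Definition slab (a b : R) : set Z := [set z | a < height z < b].

Lemma slab_open a b : open (slab a b).
Proof.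
have -> : slab a b = height @^-1` `]a, b[%classic.
  by apply/seteqP; split => z; rewrite /slab /= in_itv.
by apply: open_comp => [z _|]; [exact: height_cont | exact: interval_open].
Qed.

(** Covers both kinds of slab, around [X_i] at an integer height and around [Y_j] at a half-integer
    one. The hypotheses say that gluing inside the slab happens at height [c] only, and that each
    piece meeting the slab reaches level [c] through a continuous map to [P]. *)
Lemma chi_slab (a b c : R) (P : topologicalType) (p0 : P) (g : P -> Z) e : a < c < b ->
  (forall j t, (1 <= j <= n)%N -> cell j t -> a < t < b -> cell j c) ->
  (forall i, (i <= n)%N -> a < i%:R < b -> i%:R = c) ->
  continuous g -> injective g -> (forall p, height (g p) = c) ->
  (forall i, (i <= n)%N -> a < i%:R < b ->
     exists k : X i -> P, continuous k /\ forall x, qX i x = g (k x)) ->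
  (forall j t, (1 <= j <= n)%N -> cell j t -> a < t < b ->
     exists k : Y j -> P, continuous k /\ forall y, qY j y c = g (k y)) ->
  chi [set: P] e -> chi (slab a b) e.
Proof.
move=> hc hcell hint gcont ginj gh hX hY.
pose mv (s t : R) := t + clamp 0 1 s * (c - t).
have k01 s : 0 <= clamp 0 1 s <= 1 by apply: clamp_in.
have mv_ab s t : a < t < b -> a < mv s t < b.
  move=> /andP [h1 h2]; have /andP [h3 h4] := hc.
  have := lerp_between t c (k01 s); rewrite -/(mv s t) => /andP [h5 h6].
  by rewrite (lt_le_trans _ h5) ?lt_min ?h1 // (le_lt_trans h6) // gt_max h2.
have mv_cell s j t : cell j t -> cell j c -> cell j (mv s t).
  move=> /andP [h1 h2] /andP [h3 h4].
  have := lerp_between t c (k01 s); rewrite -/(mv s t) => /andP [h5 h6].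
  by apply/andP; rewrite (le_trans _ h5) ?le_min ?h1 // (le_trans h6) // ge_max h2.
(* Points outside the slab are left fixed; this may break continuity at the border, but not at
   points of the open slab. Inside, an integer height equals [c], which [mv] fixes, so the formulas
   agree on glued points. *)
have /choice [H hH] : forall s, exists F : Z -> Z,
    (forall i x, (i <= n)%N -> F (qX i x) = qX i x) /\
    (forall j y t, (1 <= j <= n)%N -> cell j t ->
       F (qY j y t) = if a < t < b then qY j y (mv s t) else qY j y t).
  move=> s; apply: (@glue_desc Z (fun i x => qX i x)
    (fun j y t => if a < t < b then qY j y (mv s t) else qY j y t)) => [j y nj|i y ni].
    case: ifP => [/hint jc|_]; last exact: glue_lower.
    by rewrite /mv -jc ?subrr ?mulr0 ?addr0 ?glue_lower //; case/andP: nj.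
  case: ifP => [/hint ic|_]; last exact: glue_upper.
  by rewrite /mv -ic ?subrr ?mulr0 ?addr0 ?glue_upper // ltnW.
have HX s i x : (i <= n)%N -> H s (qX i x) = qX i x by exact: (hH s).1.
have HY s j y t : (1 <= j <= n)%N -> cell j t -> a < t < b -> H s (qY j y t) = qY j y (mv s t).
  by move=> nj ct tab; rewrite (hH s).2 // tab.
have slabX i x : (i <= n)%N -> slab a b (qX i x) -> a < i%:R < b.
  by move=> ni; rewrite /slab /= heightX.
have slabY j y t : (1 <= j <= n)%N -> cell j t -> slab a b (qY j y t) -> a < t < b.
  by move=> nj ct; rewrite /slab /= heightY.
have slab_qc j p : (1 <= j <= n)%N -> slab a b (@qc j p) -> a < clamp (j%:R - 1) j%:R p.2 < b.
  by move=> nj; rewrite /slab /= height_qc.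
(* At time 1 the slab has reached the image of [g]; [r] inverts [g] there, with [p0] as default
   value. *)
pose r (z : Z) : P := xget p0 [set p | g p = H 1 z].
have rE p z : H 1 z = g p -> r z = p.
  move=> hz; rewrite /r; case: xgetP => [p' _ /= h|/(_ p)]; first by apply: ginj; rewrite h.
  by case/(_ (esym hz)).
have mv1 t : mv 1 t = c by rewrite /mv clampE ?lexx ?ler01 // mul1r addrC subrK.
have mv0 t : mv 0 t = t by rewrite /mv clampE ?lexx ?ler01 // mul0r addr0.
(* The height test is true on a whole neighbourhood, so continuity may be checked on the branch that
   moves points. *)
have near_slab j (p : Y j * R) : (1 <= j <= n)%N -> slab a b (qc p) ->
    nbhs p [set p' | a < clamp (j%:R - 1) j%:R p'.2 < b].
  move=> nj /(slab_qc _ _ nj) hp; apply: open_nbhs_nbhs; split => //.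
  rewrite (_ : mkset _ = (fun p : Y j * R => clamp (j%:R - 1) j%:R p.2) @^-1` `]a, b[%classic).
    apply: open_comp; last exact: interval_open.
    by move=> q _; exact: continuous_clamp_snd.
  by apply/seteqP; split => z; rewrite /= in_itv.
apply: (@chi_homotopy_equiv _ _ _ _ g r (fun z s => H s z)).
- by split => [p _|p _]; [rewrite /slab /= gh | exact: gcont].
- split => // z0; apply: (glue_continuous1 (slab_open a b)) => [i x ni Ux|j p nj Up].
    have [k [kc kE]] := hX i ni (slabX _ _ ni Ux).
    rewrite (_ : (fun x => _) = k); first exact: kc.
    by apply/funext => x'; apply: rE; rewrite HX.
  have [k [kc kE]] := hY j _ nj (cell_clamp j p.2) (slab_qc _ _ nj Up).
  have kc' : {for p, continuous (fun q : Y j * R => k q.1)}.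
    by apply: (@continuous_comp _ _ _ fst k); [exact: cvg_fst | exact: kc].
  have rk (q : Y j * R) : a < clamp (j%:R - 1) j%:R q.2 < b -> r (qc q) = k q.1.
    by move=> hq; apply: rE; rewrite HY ?mv1 ?kE //; exact: cell_clamp.
  move=> A; rewrite /= rk; last exact: slab_qc.
  move=> Ak; have hA : nbhs p [set q : Y j * R | A (k q.1)] by exact: kc'.
  apply: (filterS _ (filterI (near_slab j p nj Up) hA)) => q [/rk hq Aq].
  by rewrite /preimage /= hq.
- move=> p _; apply: rE.
  have gab : a < height (g p) < b by rewrite gh.
  case: (glue_surj (g p)) => [[i [x [ni ->]]]|[j [y [t [nj ct zt]]]]]; first exact: HX.
  have tc : t = c by rewrite -(gh p) zt heightY.
  by rewrite zt HY ?mv1 ?tc // -tc.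
- split => [z s|z s Uz].
    case: (glue_surj z) => [[i [x [ni ->]]]|[j [y [t [nj ct ->]]]]] Uz; first by rewrite HX.
    have tab := slabY _ _ _ nj ct Uz.
    rewrite HY // /slab /= heightY //; first exact: mv_ab.
    by apply: mv_cell => //; exact: hcell tab.
  apply: (@glue_continuous Z (slab a b) (fun z s => H s z) (slab_open a b) _ _ z s Uz) =>
      [i x t ni Ux|j p t nj Up].
    rewrite (_ : (fun p => _) = (fun p : X i * R => qX i p.1)).
      by apply: (@continuous_comp _ _ _ fst (qX i)); [exact: cvg_fst | exact: qX_cont].
    by apply/funext => -[x' t'] /=; rewrite HX.
  pose F (q : (Y j * R) * R) : Z := qc (q.1.1, mv q.2 (clamp (j%:R - 1) j%:R q.1.2)).
  have Fc : {for (p, t), continuous F}.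
    apply: (@continuous_comp _ _ _
      (fun q : (Y j * R) * R => (q.1.1, mv q.2 (clamp (j%:R - 1) j%:R q.1.2))) (@qc j));
          last exact: qc_cont.
    have c1 : {for (p, t), continuous (fun q : (Y j * R) * R => clamp (j%:R - 1) j%:R q.1.2)}.
      apply: (@continuous_comp _ _ _ fst (fun p : Y j * R => clamp (j%:R - 1) j%:R p.2)).
        exact: cvg_fst.
      exact: continuous_clamp_snd.
    apply: continuous_pair.
      by apply: (@continuous_comp _ _ _ fst fst); exact: cvg_fst.
    apply: continuousRD => //; apply: continuousRM.
      apply: (@continuous_comp _ _ _ snd (clamp 0 1)); first exact: cvg_snd.
      exact: continuous_clamp.
    apply: continuousRD; first exact: cst_continuous.
    exact: continuousRN c1.
  have HF (q : Y j * R) s' : a < clamp (j%:R - 1) j%:R q.2 < b -> H s' (qc q) = F (q, s').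
    move=> hq; rewrite HY //; last exact: cell_clamp.
    rewrite /F qcE //; apply: mv_cell; first exact: cell_clamp.
    exact: hcell (cell_clamp j q.2) hq.
  move=> A; rewrite /= HF; last exact: slab_qc.
  move=> AF; have hA : nbhs (p, t) [set q | A (F q)] by exact: Fc.
  have hns : nbhs (p, t) (fst @^-1` [set p' : Y j * R | a < clamp (j%:R - 1) j%:R p'.2 < b]).
    by apply: cvg_fst; exact: near_slab.
  apply: (filterS _ (filterI hns hA)) => -[q s'] [/= hq Aq].
  by rewrite /preimage /= HF.
- move=> z Uz; case: (glue_surj z) Uz => [[i [x [ni ->]]]|[j [y [t [nj ct ->]]]]] Uz.
    exact: HX.
  by rewrite HY ?mv0 //; exact: slabY Uz.
- move=> z Uz; case: (glue_surj z) Uz => [[i [x [ni ->]]]|[j [y [t [nj ct ->]]]]] Uz.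
    have [k [kc kE]] := hX i ni (slabX _ _ ni Uz).
    by rewrite (rE (k x)) ?HX.
  have tab := slabY _ _ _ nj ct Uz; have [k [kc kE]] := hY j t nj ct tab.
  by rewrite HY // mv1 (rE (k y)) ?HY ?mv1.
Qed.

Lemma cell_near i j t : cell j t -> i%:R - 1 < t < i%:R + 1 -> j = i \/ j = i.+1.
Proof.
move=> /andP [h1 h2] /andP [h3 h4].
have : (i < j.+1)%N by rewrite -(ltr_nat R) -natr1; lra.
have : (j < i.+2)%N by rewrite -(ltr_nat R) -!natr1; lra.
lia.
Qed.

(** Only the cells [i] and [i + 1] can meet this slab, and they collapse onto [X_i] through [fl i]
    and [fu i]. *)
Lemma chi_star i : (i <= n)%N -> (exists e, chi [set: X i] e) ->
  exists e, chi [set: X i] e /\ chi (slab (i%:R - 1) (i%:R + 1)) e.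
Proof.
move=> ni [e he].
(* If [X i] is empty there is no default point for the retraction; but then [fl] and [fu] force the
   adjacent [Y] to be empty, and so is the slab. *)
have [[x0]|nX] := pselect (inhabited (X i)); last first.
  exists 0; split.
    by apply: chi_empty => x _; apply: nX; split.
  apply: chi_empty => z.
  rewrite /slab /=; case: (glue_surj z) => [[k [x [nk ->]]]|[j [y [t [nj ct ->]]]]].
    rewrite heightX // => hk; apply: nX; suff <- : k = i by split.
    have [] // := @cell_near i k k%:R _ hk; first by rewrite /cell lexx gerBl ler01.
    by move=> ki; move: hk; rewrite ki -natr1 ltxx andbF.
  rewrite heightY // => /(cell_near ct) [] ej; subst j; apply: nX; split.
    exact: fl y.
  exact: fu y.
exists e; split => //.
have natcell : cell i i%:R by rewrite /cell lexx gerBl ler01.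
have iab : i%:R - 1 < (i%:R : R) < i%:R + 1 by apply/andP; split; lra.
have eqi k : i%:R - 1 < (k%:R : R) < i%:R + 1 -> k = i.
  move=> hk; have [] // := @cell_near i k k%:R _ hk; first by rewrite /cell lexx gerBl ler01.
  by move=> ki; move: hk; rewrite ki -natr1 ltxx andbF.
apply: (@chi_slab _ _ i%:R (X i) x0 (qX i)) => //.
- move=> j t nj ct /(cell_near ct) [] -> //.
  by rewrite /cell -natr1 addrK lexx /=; lra.
- by move=> k nk /eqi ->.
- exact: qX_cont.
- by move=> x x'; exact: glue_injX.
- by move=> x; exact: heightX.
- by move=> k nk /eqi ek; subst k; exists id; split => // x; exact: cvg_id.
- move=> j t nj ct /(cell_near ct) [] ej; subst j.
    by exists (fl i); split => [|y]; [exact: fl_cont | exact: glue_lower].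
  by exists (fu i); split => [|y]; [exact: fu_cont | exact: glue_upper].
Qed.

(** No integer lies strictly between [j - 1] and [j], so no gluing takes place in this slab and it
    collapses onto its middle level. *)
Lemma chi_mid j : (1 <= j <= n)%N -> (exists e, chi [set: Y j] e) ->
  exists e, chi [set: Y j] e /\ chi (slab (j%:R - 1) j%:R) e.
Proof.
move=> nj [e he].
have eqj k t : cell k t -> j%:R - 1 < t < j%:R -> k = j.
  move=> /andP [h1 h2] /andP [h3 h4].
  have : (j < k.+1)%N by rewrite -(ltr_nat R) -natr1; lra.
  have : (k < j.+1)%N by rewrite -(ltr_nat R) -natr1; lra.
  lia.
have noint i : ~ (j%:R - 1 < (i%:R : R) < j%:R).
  move=> /andP []; rewrite ltrBlDr natr1 !ltr_nat; lia.
have [[y0]|nY] := pselect (inhabited (Y j)); last first.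
  exists 0; split.
    by apply: chi_empty => y _; apply: nY; split.
  apply: chi_empty => z.
  rewrite /slab /=; case: (glue_surj z) => [[k [x [nk ->]]]|[k [y [t [nk ct ->]]]]].
    by rewrite heightX // => /noint.
  by rewrite heightY // => /(eqj _ _ ct) ek; subst k; apply: nY; split.
exists e; split => //.
pose c : R := j%:R - 2^-1.
have cab : j%:R - 1 < c < j%:R by rewrite /c; apply/andP; split; lra.
have cc : cell j c by rewrite /cell /c; apply/andP; split; lra.
apply: (@chi_slab _ _ c (Y j) y0 (fun y => qY j y c)) => //.
- by move=> k t nk ct /(eqj _ _ ct) ->.
- by move=> i ni /noint.
- rewrite (_ : (fun y => _) = (fun y => qc (y, c))); last by apply/funext => y; rewrite qcE.
  move=> y; apply: (@continuous_comp _ _ _ (fun y => (y, c)) (@qc j)); last exact: qc_cont.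
  by apply: continuous_pair; [exact: cvg_id | exact: cst_continuous].
- by move=> y y'; exact: glue_injY.
- by move=> y; exact: heightY.
- by move=> i ni /noint.
- by move=> k t nk ct /(eqj _ _ ct) ek; subst k; exists id; split => // y; exact: cvg_id.
Qed.

Lemma height_bounds z : 0 <= height z <= n%:R.
Proof.
case: (glue_surj z) => [[i [x [ni ->]]]|[j [y [t [nj ct ->]]]]].
  by rewrite heightX // ler0n ler_nat.
rewrite heightY //; case/andP: ct => h1 h2; case/andP: nj => j1 jn.
have : (1 : R) <= j%:R by rewrite ler1n.
have : (j%:R : R) <= n%:R by rewrite ler_nat.
by move=> h3 h4; apply/andP; split; lra.
Qed.

Lemma chi_gluing (eX eY : nat -> int) :
  (forall i, (i <= n)%N -> chi (slab (i%:R - 1) (i%:R + 1)) (eX i)) ->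
  (forall j, (1 <= j <= n)%N -> chi (slab (j%:R - 1) j%:R) (eY j)) ->
  chi [set: Z] (\sum_(i < n.+1) eX i - \sum_(1 <= j < n.+1) eY j).
Proof.
move=> hX hY.
(* Heights are at least 0, so the bound -1 only serves to write the sublevel sets as slabs. *)
suff H k : (k <= n)%N -> chi (slab (-1) (k%:R + 1))
    (\sum_(i < k.+1) eX i - \sum_(1 <= j < k.+1) eY j).
  rewrite (_ : setT = slab (-1) (n%:R + 1)); first exact: H.
  apply/seteqP; split => z // _; have /andP [h1 h2] := height_bounds z.
  by rewrite /slab /=; apply/andP; split; lra.
elim: k => [|k IH] kn.
  have := hX 0%N (leq0n n); rewrite big_ord1 big_geq // subr0.
  by rewrite (_ : 0%:R - 1 = -1 :> R) ?sub0r.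
rewrite big_ord_recr (big_nat_recr k.+1) //=.
rewrite (_ : slab (-1) (k.+1%:R + 1) =
  slab (-1) (k%:R + 1) `|` slab (k.+1%:R - 1) (k.+1%:R + 1)); last first.
  apply/seteqP; split => z; have /andP [h1 h2] := height_bounds z; rewrite /slab /= -natr1.
    move=> /andP [h3 h4]; case: (ltP (height z) (k%:R + 1)) => h5; [left|right];
      by apply/andP; split; lra.
  have k0 : (0 : R) <= k%:R by exact: ler0n.
  by case=> /andP [h3 h4]; apply/andP; split; lra.
have -> : \sum_(i < k.+1) eX i + eX k.+1 - (\sum_(1 <= j < k.+1) eY j + eY k.+1) =
    (\sum_(i < k.+1) eX i - \sum_(1 <= j < k.+1) eY j) + eX k.+1 - eY k.+1.
  by rewrite opprD addrA; congr (_ + _); exact: addrAC.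
apply: chi_mayer_vietoris; [exact: slab_open|exact: slab_open| | |].
- exact: IH (ltnW kn).
- exact: hX.
- rewrite (_ : _ `&` _ = slab (k.+1%:R - 1) k.+1%:R); first by apply: hY; rewrite kn.
  apply/seteqP; split => z; rewrite /slab /= -natr1.
    by move=> [/andP [h3 h4] /andP [h5 h6]]; apply/andP; split; lra.
  have k0 : (0 : R) <= k%:R by exact: ler0n.
  by move=> /andP [h3 h4]; split; apply/andP; split; lra.
Qed.

Lemma chi_glued :
  (forall i, (i <= n)%N -> exists e, chi [set: X i] e) ->
  (forall j, (1 <= j <= n)%N -> exists e, chi [set: Y j] e) ->
  exists eX eY : nat -> int,
    [/\ forall i, (i <= n)%N -> chi [set: X i] (eX i),
        forall j, (1 <= j <= n)%N -> chi [set: Y j] (eY j)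
      & chi [set: Z] (\sum_(i < n.+1) eX i - \sum_(1 <= j < n.+1) eY j)].
Proof.
move=> hX hY.
have /choice [eX heX] : forall i, exists e, (i <= n)%N ->
    chi [set: X i] e /\ chi (slab (i%:R - 1) (i%:R + 1)) e.
  move=> i; have [ni|] := boolP (i <= n)%N; last by exists 0.
  by have [e he] := chi_star ni (hX i ni); exists e.
have /choice [eY heY] : forall j, exists e, (1 <= j <= n)%N ->
    chi [set: Y j] e /\ chi (slab (j%:R - 1) j%:R) e.
  move=> j; have [nj|] := boolP (1 <= j <= n)%N; last by exists 0.
  by have [e he] := chi_mid nj (hY j nj); exists e.
exists eX, eY; split => [i /heX []|j /heY []|] //.
by apply: chi_gluing => [i /heX []|j /heY []].
Qed.

End Gluing.

Lemma existT_inj (T : nat -> Type) i (x y : T i) : existT T i x = existT T i y -> x = y.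
Proof. exact: (Eqdep_dec.inj_pair2_eq_dec nat PeanoNat.Nat.eq_dec T i x y). Qed.

(** * From the definition of a fibrous decomposition to the gluing hypotheses *)

Section Decomposition.
Variables (Z : topologicalType) (n : nat) (X Y : nat -> topologicalType).
Variables (A : forall i, set (X i)) (fl : forall i, Y i -> X i) (fu : forall i, Y i.+1 -> X i).
Variables (qX : forall i, X i -> Z) (qY : forall j, Y j -> R -> Z).
Arguments A : clear implicits.
Arguments fl : clear implicits.
Arguments fu : clear implicits.
Arguments qX : clear implicits.
Arguments qY : clear implicits.

Let q (u : fpt X Y) : Z :=
  match u with
  | inl (existT i a) => qX i a
  | inr (existT j (y, t)) => qY j y t
  end.

Hypothesis q_eq : forall u v, fpt_valid n u -> fpt_valid n v ->
  (q u = q v <-> u = v \/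
     exists w, fpt_anchor A fl fu u = Some w /\ fpt_anchor A fl fu v = Some w).

Lemma fpt_inlP i (a b : X i) :
  inl (existT _ i a) = inl (existT _ i b) :> fpt X Y -> a = b.
Proof. by move=> [/(@existT_inj (fun i => X i))]. Qed.

Lemma fpt_inrP j (p p' : Y j * R) :
  inr (existT (fun j => (Y j * R)%type) j p) = inr (existT _ j p') :> fpt X Y -> p = p'.
Proof.
by move=> [/(@existT_inj (fun j => (Y j * R)%type))].
Qed.

Lemma qX_inj i a b : (i <= n)%N -> qX i a = qX i b -> a = b.
Proof.
move=> ni; have := @q_eq (inl (existT _ i a)) (inl (existT _ i b)) ni ni.
move=> h /h [/fpt_inlP //|[w []]] /=.
case: asboolP => // _ [<-]; case: asboolP => // _ [].
by move/(@existT_inj (fun i => X i)).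
Qed.

(** Points of the open cell have no anchor, so nothing is identified there. *)
Lemma qY_inj j y y' t t' : (1 <= j <= n)%N -> j%:R - 1 < t < j%:R -> j%:R - 1 < t' < j%:R ->
  qY j y t = qY j y' t' -> (y, t) = (y', t').
Proof.
move=> nj /andP [t1 t2] /andP [t1' t2'].
have := @q_eq (inr (existT _ j (y, t))) (inr (existT _ j (y', t'))).
case; [by rewrite /= !ltW|by rewrite /= !ltW|move=> h _ /h [/fpt_inrP //|[w []]]] => /=.
case: asboolP => [tj|_]; first by rewrite tj ltxx in t2.
by case: asboolP => // tj; rewrite tj ltxx in t1.
Qed.

Hypothesis fl_range : forall i, (1 <= i <= n)%N -> range (fl i) = A i.
Hypothesis fu_range : forall i, (i < n)%N -> range (fu i) = A i.

Lemma qY_lower j y : (1 <= j <= n)%N -> qY j y j%:R = qX j (fl j y).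
Proof.
move=> nj; have nj' : (j <= n)%N by case/andP: nj.
apply: (iffRL (@q_eq (inr (existT _ j (y, j%:R))) (inl (existT _ j (fl j y))) _ _)) => //=.
  by split => //; rewrite lexx gerBl ler01.
right; exists (existT _ j (fl j y)); case: asboolP => // _; case: asboolP => // nA.
by case: nA; rewrite -(fl_range nj); exists y.
Qed.

Lemma qY_upper i y : (i < n)%N -> qY i.+1 y i%:R = qX i (fu i y).
Proof.
move=> ni; have ni' := ltnW ni.
apply: (iffRL (@q_eq (inr (existT _ i.+1 (y, i%:R))) (inl (existT _ i (fu i y))) _ _)) => //=.
  by rewrite -natr1 addrK lexx lerDl ler01.
right; exists (existT _ i (fu i y)); case: asboolP => [/eqP|_].
  by rewrite eqr_nat => /eqP /n_Sn.
case: asboolP => [_|]; last by rewrite -natr1 addrK.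
split => //; case: asboolP => // nA.
by case: nA; rewrite -(fu_range ni); exists y.
Qed.

Hypothesis q_surj : forall z, exists u, fpt_valid n u /\ q u = z.

Lemma glued_points z :
  (exists i a, (i <= n)%N /\ z = qX i a) \/
  (exists j y t, [/\ (1 <= j <= n)%N, cell j t & z = qY j y t]).
Proof.
have [[[i a]|[j [y t]]] [/= hu <-]] := q_surj z; first by left; exists i, a.
by right; exists j, y, t; case: hu.
Qed.

(** The map evaluates [g] at a chosen representative. This is well defined because [g] takes at a
    point with an anchor its value at the anchor, and distinct identified points share an anchor. *)
Lemma glued_map (W : Type) (gX : forall i, X i -> W) (gY : forall j, Y j -> R -> W) :
  (forall j y, (1 <= j <= n)%N -> gY j y j%:R = gX j (fl j y)) ->
  (forall i y, (i < n)%N -> gY i.+1 y i%:R = gX i (fu i y)) ->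
  exists G : Z -> W, (forall i a, (i <= n)%N -> G (qX i a) = gX i a) /\
    (forall j y t, (1 <= j <= n)%N -> cell j t -> G (qY j y t) = gY j y t).
Proof.
move=> glo gup.
pose g (u : fpt X Y) : W := match u with
  | inl (existT i a) => gX i a | inr (existT j (y, t)) => gY j y t end.
have g_anchor u w : fpt_valid n u -> fpt_anchor A fl fu u = Some w ->
    g u = gX (projT1 w) (projT2 w).
  case: u => [[k b]|[[|j] [y t]]] /=; first by case: asboolP => // _ _ [<-].
    by case.
  move=> [nj ct]; case: asboolP => [->|_].
    by move=> [<-]; exact: glo.
  case: asboolP => // -> [<-]; rewrite -natr1 addrK; exact: gup.
have g_eq u v : fpt_valid n u -> fpt_valid n v -> q u = q v -> g u = g v.
  move=> hu hv /(q_eq hu hv) [-> //|[w0 [au av]]].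
  by rewrite (g_anchor _ _ hu au) (g_anchor _ _ hv av).
have [s hs] := choice q_surj; exists (g \o s); split => [i a ni|j y t nj ct].
  have [sv sq] := hs (qX i a).
  exact: (@g_eq _ (inl (existT _ i a)) sv ni sq).
have [sv sq] := hs (qY j y t).
exact: (@g_eq _ (inr (existT _ j (y, t))) sv (conj nj ct) sq).
Qed.

Hypothesis q_open : forall U : set Z, open U <->
  ((forall i, (i <= n)%N -> open (qX i @^-1` U)) /\
   (forall j, (1 <= j <= n)%N ->
     exists V : set (Y j * R)%type, open V /\
       V `&` [set p | j%:R - 1 <= p.2 <= j%:R] =
       (fun p => qY j p.1 p.2) @^-1` U `&` [set p | j%:R - 1 <= p.2 <= j%:R])).

Lemma glued_contX i : (i <= n)%N -> continuous (qX i).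
Proof. by move=> ni; apply/continuousP => U /q_open [h _]; exact: h. Qed.

(** The definition describes open sets of Y_j x [j - 1, j] as traces of open sets [V] of Y_j x R.
    The preimage under [qc] is then the preimage of [V] under the clamping retraction. *)
Lemma glued_contY j : (1 <= j <= n)%N -> continuous (@qc Z Y qY j).
Proof.
move=> nj; apply/continuousP => U /q_open [_ /(_ j nj) [V [oV VU]]].
rewrite (_ : _ @^-1` U = (fun p : Y j * R => (p.1, clamp (j%:R - 1) j%:R p.2)) @^-1` V).
  apply: open_comp => // p _; apply: continuous_pair; first exact: cvg_fst.
  exact: continuous_clamp_snd.
apply/seteqP; split => p.
  move=> Up; have : (V `&` [set p | j%:R - 1 <= p.2 <= j%:R]) (p.1, clamp (j%:R - 1) j%:R p.2).
    by rewrite VU; split => //; exact: cell_clamp.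
  by case.
move=> Vp; have : ((fun p => qY j p.1 p.2) @^-1` U `&` [set p | j%:R - 1 <= p.2 <= j%:R])
    (p.1, clamp (j%:R - 1) j%:R p.2).
  by rewrite -VU; split => //; exact: cell_clamp.
by case.
Qed.

Lemma glued_open (U : set Z) : (forall i, (i <= n)%N -> open (qX i @^-1` U)) ->
  (forall j, (1 <= j <= n)%N -> open (@qc Z Y qY j @^-1` U)) -> open U.
Proof.
move=> hX hY; apply/q_open; split => // j nj.
exists (@qc Z Y qY j @^-1` U); split; first exact: hY.
apply/seteqP; split => -[y t] /= [h ct]; split => //.
  by rewrite /preimage /= -(qcE qY y ct).
by rewrite /preimage /= (qcE qY y ct).
Qed.

End Decomposition.

(** * Induction on the level and the theorem *)

Lemma chi_decomposition (Z : topologicalType) (n : nat) (X Y : nat -> topologicalType)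
  (A : forall i, set (X i)) (fl : forall i, Y i -> X i) (fu : forall i, Y i.+1 -> X i) :
  fibrous_decomposition Z n X Y A fl fu ->
  (forall i, (i <= n)%N -> exists e, chi [set: X i] e) ->
  (forall j, (1 <= j <= n)%N -> exists e, chi [set: Y j] e) ->
  exists eX eY : nat -> int,
    [/\ forall i, (i <= n)%N -> chi [set: X i] (eX i),
        forall j, (1 <= j <= n)%N -> chi [set: Y j] (eY j)
      & chi [set: Z] (\sum_(i < n.+1) eX i - \sum_(1 <= j < n.+1) eY j)].
Proof.
move=> [_ [_ [hfl [hfu [qX [qY [qs [qe qo]]]]]]]].
have flc j (nj : (1 <= j <= n)%N) := (hfl j nj).1.
have fuc i (ni : (i < n)%N) := (hfu i ni).1.
have flr j (nj : (1 <= j <= n)%N) := (hfl j nj).2.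
have fur i (ni : (i < n)%N) := (hfu i ni).2.
apply: (@chi_glued Z n X Y fl fu qX qY) => //.
- exact: (qY_lower qe flr).
- exact: (qY_upper qe fur).
- exact: (glued_points qs).
- by move=> i a b; exact: (qX_inj qe).
- by move=> j y y' t nj ht /(qY_inj qe nj ht ht) [].
- exact: (glued_map qe qs).
- exact: (glued_open qo).
- exact: (glued_contX qo).
- exact: (glued_contY qo).
Qed.

(** The recursive occurrences in [fibrous] sit under an existential over smaller levels, so the
    induction is on a bound [M] for the level. *)
Lemma fibrous_chi m (Z : topologicalType) : fibrous m Z -> exists e, chi [set: Z] e.
Proof.
suff H M m' (Z' : topologicalType) : (m' <= M)%N -> fibrous m' Z' -> exists e, chi [set: Z'] e.
  exact: (H m m).
elim: M m' Z' => [|M IH] m' Z' mM hZ.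
  by case: hZ mM => // T hT fT _; exact: chi_finite.
case: hZ mM => [T hT fT _|k T n X Y A fl fu _ hdec hX hY kM]; first exact: chi_finite.
have [||eX [eY [_ _ hZ]]] := chi_decomposition hdec.
- by move=> i /hX [l [lk hl]]; apply: IH hl; exact: leq_trans lk kM.
- by move=> j /hY [l [lk hl]]; apply: IH hl; exact: leq_trans lk kM.
- by eexists; exact: hZ.
Qed.

Lemma fibrous0_finite (Z : topologicalType) : fibrous 0 Z -> finite_set [set: Z].
Proof.
move=> h; have : forall m, fibrous m Z -> m = 0%N -> finite_set [set: Z] by move=> m [].
by move=> /(_ 0%N h erefl).
Qed.

Lemma finite_decomposition (Z : topologicalType) (n : nat) (X Y : nat -> topologicalType)
  (A : forall i, set (X i)) (fl : forall i, Y i -> X i) (fu : forall i, Y i.+1 -> X i) :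
  fibrous_decomposition Z n X Y A fl fu -> finite_set [set: Z] ->
  (forall i, (i <= n)%N -> finite_set [set: X i]) /\
  (forall j, (1 <= j <= n)%N -> Y j -> False).
Proof.
move=> [_ [_ [_ [_ [qX [qY [_ [qe _]]]]]]]] fZ; split => [i ni|j nj y].
  apply: (@finite_preimage _ _ setT (qX i)) => // a b _ _; exact: (qX_inj qe).
(* A point [y] of [Y_j] would give infinitely many distinct points of the finite [Z], at the heights
   [j - 1 / (k + 2)]; the 2 keeps them strictly between [j - 1] and [j]. *)
apply: infinite_nat; rewrite -[setT]/((fun k : nat => qY j y (j%:R - k.+2%:R^-1)) @^-1` setT).
apply: finite_preimage => // k k' _ _.
have inv k0 : j%:R - 1 < (j%:R - k0.+2%:R^-1 : R) < j%:R.
  rewrite ltrD2l ltrN2 invf_lt1 ?ltr0n // ltr1n /= gtrBl invr_gt0 ltr0n //.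
move=> /(qY_inj qe nj (inv k) (inv k')) [] /addrI /oppr_inj /invr_inj /eqP.
by rewrite eqr_nat => /eqP [].
Qed.

Unset Implicit Arguments.

Theorem theorem2 (m : nat) (Z : topologicalType) (n : nat)
  (X Y : nat -> topologicalType) (A : forall i, set (X i))
  (fl : forall i, Y i -> X i) (fu : forall i, Y i.+1 -> X i) :
  fibrous m Z ->
  hausdorff_space Z ->
  fibrous_decomposition Z n X Y A fl fu ->
  ((0 < m)%N ->
     (forall i, (i <= n)%N -> exists k, (k <= m - 1)%N /\ fibrous k (X i)) /\
     (forall j, (1 <= j <= n)%N -> exists k, (k <= m - 1)%N /\ fibrous k (Y j))) ->
  exists (eX eY : nat -> int) (eZ : int),
    (forall i, (i <= n)%N -> euler_char (X i) (eX i)) /\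
    (forall j, (1 <= j <= n)%N -> euler_char (Y j) (eY j)) /\
    euler_char Z eZ /\
    eZ = \sum_(i < n.+1) eX i - \sum_(1 <= j < n.+1) eY j.
Proof.
move=> hZ _ hdec hfib.
have [hX hY] : (forall i, (i <= n)%N -> exists e, chi [set: X i] e) /\
    (forall j, (1 <= j <= n)%N -> exists e, chi [set: Y j] e).
  (* For [m = 0] the fibers are controlled by the finiteness of [Z], for [m > 0] by the hypothesis
     on their levels. *)
  case: m hZ hfib => [/fibrous0_finite fZ _|m _ [//|hX hY]].
    have [fX Y0] := finite_decomposition hdec fZ; split => [i ni|j nj].
      by apply: chi_finite; [case: hdec => + _; exact | exact: fX].
    by exists 0; apply: chi_empty => y; case: (Y0 j nj y).
  split => [i /hX|j /hY] [k [_ hk]]; exact: fibrous_chi hk.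
have [eX [eY [heX heY heZ]]] := chi_decomposition hdec hX hY.
exists eX, eY, (\sum_(i < n.+1) eX i - \sum_(1 <= j < n.+1) eY j); split.
  by move=> i /heX; exact: euler_char_of_chi.
split; first by move=> j /heY; exact: euler_char_of_chi.
by split => //; exact: euler_char_of_chi.
Qed.
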